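(* Let $\mathcal{F}$ be a Hilbert space, let $h:\mathbb{R}^p\to\mathcal{F}$ be differentiable with Lipschitz differential $Dh$, with Lipschitz constant $\mathrm{Lip}(Dh)$, and let $R:\mathcal{F}\to\mathbb{R}_+$ be $M$-smooth and $m$-strongly convex, with minimizer $y^*$ and condition number $\kappa:=M/m$. Let $w_0\in\mathbb{R}^p$. Assume that $\sigma_{\min}$, the smallest singular value of $Dh(w_0)^\intercal$, is positive, and that $$\|h(w_0)\|\le C_0:=\frac{\sigma_{\min}^3}{32\,\kappa^{3/2}\,\|Dh(w_0)\|\,\mathrm{Lip}(Dh)}.$$ For $\alpha>0$ let $w_\alpha$ and $\bar w_\alpha$ be the gradient flows, started from $w_0$, of the scaled objective $F_\alpha$ and of the scaled linearized objective $\bar F_\alpha$ (as defined in the context). If $\alpha>\|y^*\|/C_0$, then for all $t\ge 0$, $$\|\alpha h(w_\alpha(t))-y^*\|\le\sqrt{\kappa}\,\|\alpha h(w_0)-y^*\|\,\exp(-m\sigma_{\min}^2t/4).$$ If moreover $h(w_0)=0$, then as $\alpha\to\infty$, $$\sup_{t\ge0}\|w_\alpha(t)-w_0\|=O(1/\alpha),\qquad \sup_{t\ge0}\|\alpha h(w_\alpha(t))-\alpha\bar h(\bar w_\alpha(t))\|=O(1/\alpha),$$ $$\sup_{t\ge0}\|w_\alpha(t)-\bar w_\alpha(t)\|=O(\log\alpha/\alpha^2).$$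
   Context: $Dh(w):\mathbb{R}^p\to\mathcal{F}$ denotes the differential of $h$ at $w$, a continuous linear map, and $Dh(w)^\intercal:\mathcal{F}\to\mathbb{R}^p$ its adjoint; the norm $\|Dh(w_0)\|$ and the Lipschitz constant of $w\mapsto Dh(w)$ are with respect to the operator norm. That the smallest singular value $\sigma_{\min}$ of $Dh(w_0)^\intercal$ is positive means $\|Dh(w_0)^\intercal v\|\ge\sigma_{\min}\|v\|$ for all $v\in\mathcal{F}$ with $\sigma_{\min}>0$ (largest such constant), i.e. $Dh(w_0)$ is surjective; in particular $\mathcal{F}$ is finite-dimensional. If $\mathrm{Lip}(Dh)=0$, $C_0$ is understood as $+\infty$. $M$-smooth means differentiable with $M$-Lipschitz gradient. The linearized model at $w_0$ is $\bar h(w) := h(w_0)+Dh(w_0)(w-w_0)$. For $\alpha>0$, set $$F_\alpha(w):=\frac{1}{\alpha^2}R(\alpha h(w)),\qquad \bar F_\alpha(w):=\frac{1}{\alpha^2}R(\alpha\bar h(w)).$$ The gradient flow $(w_\alpha(t))_{t\ge 0}$ of $F_\alpha$ satisfies $w_\alpha(0)=w_0$ and $$w_\alpha'(t)=-\nabla F_\alpha(w_\alpha(t))=-\frac1\alpha Dh(w_\alpha(t))^\intercal\nabla R(\alpha h(w_\alpha(t))).$$ The gradient flow $(\bar w_\alpha(t))_{t\ge 0}$ of $\bar F_\alpha$ satisfies $\bar w_\alpha(0)=w_0$ and $$\bar w_\alpha'(t)=-\nabla\bar F_\alpha(\bar w_\alpha(t))=-\frac1\alpha Dh(w_0)^\intercal\nabla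 R(\alpha\bar h(\bar w_\alpha(t))).$$ The notation $O(\cdot)$ refers to $\alpha\to\infty$, with constants independent of $\alpha$. *)

(* Defs.v *)
From HB Require Import structures.
From mathcomp Require Import all_boot all_order all_algebra.
From mathcomp Require Import all_classical all_reals all_analysis.
From mathcomp Require Import ring lra.

Set Implicit Arguments.
Unset Strict Implicit.
Unset Printing Implicit Defensive.

Import Order.TTheory GRing.Theory Num.Theory.
Import numFieldNormedType.Exports.

Local Open Scope classical_set_scope.
Local Open Scope ring_scope.

HB.mixin Record isHilbert (R : realType) V & CompleteNormedModule R V := {
  dot : V -> V -> R;
  dotC : forall x y, dot x y = dot y x;
  dotDl : forall x y z, dot (x + y) z = dot x z + dot y z;
  dotZl : forall (a : R) x y, dot (a *: x) y = a * dot x y;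
  dotxx : forall x, dot x x = `|x| ^+ 2
}.

#[short(type="hilbertType")]
HB.structure Definition Hilbert (R : realType) :=
  {V of CompleteNormedModule R V & isHilbert R V}.

(* R^p: the library norm on ['rV[R]_p] is the sup norm; [euclid R p] is the same
   vector space with the norm [sqrt (\sum_i x_i ^ 2)]. *)

Definition euclid (R : realType) (p : nat) : Type := 'rV[R]_p.

Section Euclid.
Variables (R : realType) (p : nat).
Local Notation E := (euclid R p).

HB.instance Definition _ := GRing.Lmodule.copy E 'rV[R]_p.

Definition edot (x y : E) : R := \sum_(i < p) x 0 i * y 0 i.

Definition enorm (x : E) : R := Num.sqrt (edot x x).

Lemma edotC x y : edot x y = edot y x.
Proof. by apply: eq_bigr => i _; rewrite mulrC. Qed.

Lemma edotDl x y z : edot (x + y) z = edot x z + edot y z.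
Proof. by rewrite -big_split; apply: eq_bigr => i _; rewrite mxE mulrDl. Qed.

Lemma edotZl (a : R) x y : edot (a *: x) y = a * edot x y.
Proof. by rewrite mulr_sumr; apply: eq_bigr => i _; rewrite mxE mulrA. Qed.

Lemma edot_ge0 x : 0 <= edot x x.
Proof. by apply: sumr_ge0 => i _; rewrite -expr2 sqr_ge0. Qed.

Lemma enorm_sqr x : enorm x ^+ 2 = edot x x.
Proof. by rewrite sqr_sqrtr// edot_ge0. Qed.

Lemma enorm_ge0 x : 0 <= enorm x.
Proof. exact: sqrtr_ge0. Qed.

Lemma edot_le x y : edot x y <= enorm x * enorm y.
Proof.
have P t : 0 <= edot x x - 2 * t * edot x y + t ^+ 2 * edot y y.
  have := edot_ge0 (x + (- t) *: y).
  rewrite !(edotDl, edotZl) !(edotC _ (_ + _)) !(edotDl, edotZl) (edotC y x).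
  by move=> H; rewrite (_ : _ + _ = edot x x + - t * edot x y +
    - t * (edot x y + - t * edot y y)) //; ring.
apply: le_trans (ler_norm _) _.
rewrite -(@ler_pXn2r _ 2)// ?nnegrE ?mulr_ge0 ?enorm_ge0//.
rewrite exprMn !enorm_sqr real_normK ?num_real//.
have [c0|c0] := eqVneq (edot y y) 0.
  have [->|b0] := eqVneq (edot x y) 0.
    by rewrite expr0n mulr_ge0 ?edot_ge0.
  have := P ((edot x x + 1) / (2 * edot x y)).
  rewrite c0 mulr0 addr0 (_ : _ - _ = - 1); last by field.
  by rewrite oppr_ge0 ler10.
have cp : 0 < edot y y by rewrite lt_def c0 edot_ge0.
have := P (edot x y / edot y y).
rewrite (_ : _ + _ = (edot x x * edot y y - edot x y ^+ 2) / edot y y); last by field.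
by rewrite pmulr_lge0 ?invr_gt0// subr_ge0.
Qed.

Lemma enormD x y : enorm (x + y) <= enorm x + enorm y.
Proof.
rewrite -(@ler_pXn2r _ 2)// ?nnegrE ?addr_ge0 ?enorm_ge0//.
rewrite enorm_sqr edotDl !(edotC _ (_ + _)) !edotDl sqrrD !enorm_sqr (edotC y x).
by have := edot_le x y; lra.
Qed.

Lemma enormZ (a : R) x : enorm (a *: x) = `|a| * enorm x.
Proof.
rewrite /enorm edotZl edotC edotZl mulrA -expr2 sqrtrM ?sqr_ge0//.
by rewrite sqrtr_sqr.
Qed.

Lemma enorm_coord (x : E) i : `|x 0 i| <= enorm x.
Proof.
rewrite -sqrtr_sqr ler_sqrt ?edot_ge0// /edot (bigD1 i)//= -expr2 lerDl.
by apply: sumr_ge0 => j _; rewrite -expr2 sqr_ge0.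
Qed.

Lemma enorm_le_sum (x : E) : enorm x <= \sum_(i < p) `|x 0 i|.
Proof.
rewrite -(@ler_pXn2r _ 2)// ?nnegrE ?enorm_ge0 ?sumr_ge0//.
rewrite enorm_sqr expr2 mulr_suml; apply: ler_sum => i _.
rewrite -expr2 -real_normK ?num_real// expr2 ler_wpM2l//.
by rewrite (bigD1 i)//= lerDl sumr_ge0.
Qed.

Lemma enorm0_eq0 x : enorm x = 0 -> x = 0.
Proof.
move=> x0; apply/rowP => i; rewrite mxE; apply/eqP; rewrite -normr_le0 -x0.
exact: enorm_coord.
Qed.

HB.instance Definition _ :=
  Lmodule_isNormed.Build R E enormD enormZ enorm0_eq0.

Lemma euclid_normE (x : E) : `|x| = Num.sqrt (\sum_(i < p) x 0 i ^+ 2).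
Proof. by congr Num.sqrt; apply: eq_bigr => i _; rewrite expr2. Qed.

Lemma euclid_complete (G : set_system E) :
  ProperFilter G -> cauchy G -> cvg G.
Proof.
move=> FG /cauchy_ballP cG.
have cv i : cvg ((fun x : E => x 0 i) @ G).
  apply: cauchy_cvg; apply/cauchy_ballP => e e0.
  rewrite near_map2; apply: filterS (cG _ e0) => -[x y] /=.
  rewrite -ball_normE /= -ball_normE /= => xy.
  apply: le_lt_trans xy; have := enorm_coord (x - y) i.
  by rewrite !mxE.
pose l : E := \row_i lim ((fun x : E => x 0 i) @ G).
apply/cvg_ex; exists l; apply/cvgrPdist_lt => e e0.
have p0 : 0 < p%:R + 1 :> R by rewrite ltr_wpDl.
have H : \forall x \near G,
    forall i : 'I_p, `|l 0 i - (x : E) 0 i| < e / (p%:R + 1).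
  apply: filter_forall => i.
  have /cvgrPdist_lt/(_ (e / (p%:R + 1))) := cv i.
  by rewrite /l mxE; apply; rewrite divr_gt0.
apply: filterS H => x Hx.
apply: (le_lt_trans (enorm_le_sum _)).
apply: (@le_lt_trans _ _ (\sum_(i < p) e / (p%:R + 1))).
  by apply: ler_sum => i _; have := ltW (Hx i); rewrite !mxE.
rewrite sumr_const card_ord -[X in X < _]mulr_natr mulrAC ltr_pdivrMr//.
by rewrite ltr_pM2l// ltrDl.
Qed.

HB.instance Definition _ := Uniform_isComplete.Build E euclid_complete.

Lemma edotxx (x : E) : edot x x = `|x| ^+ 2.
Proof. by rewrite -enorm_sqr. Qed.

HB.instance Definition _ := isHilbert.Build R E edotC edotDl edotZl edotxx.

End Euclid.

Section Operators.
Variable R : realType.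

(* The vector representing a continuous linear form, which exists by the Riesz
   representation theorem and is unique; [0] for other [phi]. *)
Definition riesz (V : hilbertType R) (phi : V -> R) : V :=
  xget 0 [set g | forall v, dot g v = phi v].

Lemma rieszP (V : hilbertType R) (phi : V -> R) (g : V) :
  (forall v, dot g v = phi v) -> riesz phi = g.
Proof.
move=> gphi; apply: xget_unique => // g' g'phi; apply/eqP.
rewrite -subr_eq0 -normr_eq0 -sqrf_eq0 -dotxx dotDl -scaleN1r dotZl.
by rewrite gphi g'phi mulN1r subrr.
Qed.

Definition adjoint (V W : hilbertType R) (A : V -> W) (y : W) : V :=
  riesz (fun x => dot y (A x)).

Definition gradient (V : hilbertType R) (f : V -> R) (x : V) : V :=
  riesz ('d f x).

Definition opnorm (V W : normedModType R) (A : V -> W) : R :=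
  sup [set `|A x| | x in [set x | `|x| <= 1]].

(* The largest [s] with [s * `|v| <= `|B v|] for all [v]. When [V] is trivial
   there is no largest such [s] and the value is the default [0]. *)
Definition smallest_singular_value (V W : normedModType R) (B : V -> W) : R :=
  sup [set s | forall v, s * `|v| <= `|B v|].

Definition diff_lipschitz_constants (V W : normedModType R) (h : V -> W) : set R :=
  [set L | 0 <= L /\
    forall x y, opnorm (fun v => 'd h x v - 'd h y v) <= L * `|x - y|].

Definition has_lipschitz_diff (V W : normedModType R) (h : V -> W) : Prop :=
  (forall x, differentiable h x) /\ diff_lipschitz_constants h !=set0.

(* The best (least) Lipschitz constant of [w |-> Dh w] in operator norm. *)
Definition lip_diff (V W : normedModType R) (h : V -> W) : R :=
  inf (diff_lipschitz_constants h).

Definition smooth (V : hilbertType R) (M : R) (f : V -> R) : Prop :=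
  (forall x, differentiable f x) /\ M.-lipschitz (gradient f).

(* The modulus [m] is required to be positive, as [kappa = M / m] needs. *)
Definition strongly_convex (V : normedModType R) (m : R) (f : V -> R) : Prop :=
  0 < m /\ forall x y t, 0 <= t <= 1 ->
    f (t *: x + (1 - t) *: y) <=
      t * f x + (1 - t) * f y - m / 2 * (t * (1 - t)) * `|x - y| ^+ 2.

Definition linearization (V W : normedModType R) (h : V -> W) (w0 w : V) : W :=
  h w0 + 'd h w0 (w - w0).

Definition scaled_objective (V W : normedModType R) (loss : W -> R) (h : V -> W)
    (alpha : R) (w : V) : R :=
  (alpha ^+ 2)^-1 * loss (alpha *: h w).

(* Classical solution on [0, +oo): the derivative at [t = 0] is one-sided, and
   values of [w] at negative times are irrelevant. *)
Definition gradient_flow (V : hilbertType R) (f : V -> R) (w0 : V) (w : R -> V) :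
    Prop :=
  w 0 = w0 /\ forall t, 0 <= t ->
    (s - t)^-1 *: (w s - w t) @[s --> within [set s | 0 <= s] t^']
      --> - gradient f (w t).

(* [sup_{t >= 0} u alpha t = O(g alpha)] as [alpha -> +oo]. The supremum is
   taken in [\bar R], so the bound includes finiteness for large [alpha]. *)
Definition sup_bigO (u : R -> R -> R) (g : R -> R) : Prop :=
  exists C : R, \forall alpha \near +oo,
    (ereal_sup [set (u alpha t)%:E | t in [set t | (0 <= t)%R]]
       <= (C * `|g alpha|)%:E)%E.

End Operators.

(* Main.v *)
From HB Require Import structures.
Require Import Defs.
From mathcomp Require Import all_boot all_order all_algebra.
From mathcomp Require Import all_classical all_reals all_analysis.
From mathcomp Require Import ring lra.
Import Order.TTheory GRing.Theory Num.Theory.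
Import numFieldNormedType.Exports.
Local Open Scope classical_set_scope.
Local Open Scope ring_scope.

Set Implicit Arguments.
Unset Strict Implicit.
Unset Printing Implicit Defensive.

(** Both flows are studied through their outputs y = alpha h(w) and
    ybar = alpha hbar(wbar), which obey y' = - D D^T grad R(y), where D is the
    differential of the model at the current weights.

    Convergence. As long as Lip(Dh) |w - w0| <= sigma / 2, the operator D D^T is
    bounded below by sigma^2 / 4 ([lazy_flow_singular]), so the
    Polyak-Lojasiewicz inequality makes R(y) - min R decay like exp (- 2 a t)
    with a = m sigma^2 / 4; strong convexity and smoothness turn this into the
    stated decay of |y - ystar| ([lazy_flow_decay]).  The velocity of the weights
    then decays like exp (- a t) as well, so the weights travel at most
    6 kappa^(3/2) |Dh(w0)| |y(0) - ystar| / (alpha sigma^2)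
    ([lazy_flow_travel]).  The bound on |h(w0)| and the threshold on alpha make
    this length smaller than sigma / (2 Lip(Dh)) ([threshold_close]), so a
    continuous induction shows that the weights never leave that ball
    ([lazy_flow_in_tube]).

    Comparison. When h(w0) = 0 the initial distance |y(0) - ystar| does not
    depend on alpha, and the travelled length is O(1 / alpha).  Hence the two
    Gram operators differ by O(1 / alpha).  Let S be the inverse of
    Dh(w0) Dh(w0)^T and z = y - ybar.  The quantity <z, S z> is contracted by the
    strong monotonicity of grad R, and the only forcing term is
    O(exp (- a t) / alpha), so z = O(1 / alpha) uniformly in time
    ([output_gap_le]).  Since each output converges exponentially, z is also
    O(exp (- a t)); the velocities of the weights therefore differ by
    O(min (1 / alpha, exp (- a t)) / alpha), whose integral over [0, +oo[ is
    O(log alpha / alpha^2) ([weight_gap_le]).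

    Two tools serve throughout.  A symmetric Lax-Milgram theorem
    ([symmetric_lax_milgram]) provides gradients, adjoints and the operator S.
    A solution given for t >= 0 is continued by its tangent line to negative
    times ([extend_one_sided]), so that all derivatives in time are two-sided. *)

(** * Inner products and the symmetric Lax-Milgram theorem *)

Section HilbertAlgebra.
Context {R : realType} {V : hilbertType R}.
Implicit Types (x y z : V) (a : R).

Lemma dotDr x y z : dot x (y + z) = dot x y + dot x z.
Proof. by rewrite dotC dotDl !(dotC _ x). Qed.

Lemma dotZr a x y : dot x (a *: y) = a * dot x y.
Proof. by rewrite dotC dotZl dotC. Qed.

Lemma dotNl x y : dot (- x) y = - dot x y.
Proof. by rewrite -scaleN1r dotZl mulN1r. Qed.

Lemma dotNr x y : dot x (- y) = - dot x y.
Proof. by rewrite dotC dotNl dotC. Qed.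

Lemma dotBl x y z : dot (x - y) z = dot x z - dot y z.
Proof. by rewrite dotDl dotNl. Qed.

Lemma dotBr x y z : dot x (y - z) = dot x y - dot x z.
Proof. by rewrite dotDr dotNr. Qed.

Lemma normD_sqr x y : `|x + y| ^+ 2 = `|x| ^+ 2 + 2 * dot x y + `|y| ^+ 2.
Proof. by rewrite -!dotxx dotDl !dotDr (dotC y x); ring. Qed.

Lemma dot_le x y : dot x y <= `|x| * `|y|.
Proof.
have [->|x0] := eqVneq x 0; first by rewrite -(scale0r x) dotZl scale0r normr0 !mul0r.
have [->|y0] := eqVneq y 0.
  by rewrite -(scale0r y) dotZr scale0r normr0 mulr0 mul0r.
have p : 0 < `|x| * `|y| by rewrite mulr_gt0 ?normr_gt0.
have : 0 <= `| `|y| *: x + - (`|x| *: y)| ^+ 2 by rewrite sqr_ge0.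
rewrite normD_sqr normrN !normrZ !normr_id dotZl dotNr dotZr => H.
rewrite -subr_ge0 -(pmulr_rge0 _ p); lra.
Qed.

Lemma normr_dot_le x y : `|dot x y| <= `|x| * `|y|.
Proof.
rewrite ler_norml dot_le andbT lerNl -dotNl.
by rewrite (le_trans (dot_le _ _))// normrN.
Qed.

Lemma dot_inj x y : (forall z, dot x z = dot y z) -> x = y.
Proof.
move=> xy; apply/eqP; rewrite -subr_eq0 -normr_eq0 -sqrf_eq0 -dotxx.
by rewrite dotBl xy subrr.
Qed.

Lemma polarization x y : dot x y = 4^-1 * (`|x + y| ^+ 2 - `|x - y| ^+ 2).
Proof. by rewrite !normD_sqr dotNr normrN; field. Qed.

Lemma cvg_dot (T : Type) (G : set_system T) (FG : Filter G) (u v : T -> V) x y :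
  u t @[t --> G] --> x -> v t @[t --> G] --> y ->
  dot (u t) (v t) @[t --> G] --> dot x y.
Proof.
move=> ux vy; rewrite polarization.
under eq_cvg do rewrite polarization.
apply: cvgM; first exact: cvg_cst.
by apply: cvgB; apply: (@cvgM _ _ _ FG); apply: cvg_norm;
  [exact: cvgD|exact: cvgD|exact: cvgB|exact: cvgB].
Qed.

End HilbertAlgebra.

(** Evaluate at t = d / b, where the gap between the two sides is extremal. *)
Lemma quadratic_discriminant (R : realFieldType) (b d e : R) : 0 < b ->
  (forall t, 2 * t * d <= e + t ^+ 2 * b) -> d ^+ 2 <= e * b.
Proof.
move=> b0 /(_ (d / b)).
rewrite (_ : 2 * _ * d = 2 * (d ^+ 2 / b)); last by rewrite expr2; ring.
rewrite (_ : (d / b) ^+ 2 * b = d ^+ 2 / b); last by field; rewrite gt_eqF.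
by move=> H; rewrite -ler_pdivrMr//; lra.
Qed.

Section LaxMilgram.
Context {R : realType} {V : hilbertType R}.
Variables (B : V -> V -> R) (phi : V -> R) (c C D : R).
Hypothesis Bsym : forall x y, B x y = B y x.
Hypothesis BD : forall x y z, B (x + y) z = B x z + B y z.
Hypothesis BZ : forall a x y, B (a *: x) y = a * B x y.
Hypothesis c0 : 0 < c.
Hypothesis Bcoercive : forall x, c * `|x| ^+ 2 <= B x x.
Hypothesis Bbounded : forall x y, `|B x y| <= C * `|x| * `|y|.
Hypothesis phiD : forall x y, phi (x + y) = phi x + phi y.
Hypothesis phiZ : forall a x, phi (a *: x) = a * phi x.
Hypothesis phi_bounded : forall x, `|phi x| <= D * `|x|.

Let BDr x y z : B x (y + z) = B x y + B x z.
Proof. by rewrite Bsym BD !(Bsym _ x). Qed.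

Let BZr a x y : B x (a *: y) = a * B x y.
Proof. by rewrite Bsym BZ Bsym. Qed.

Let J x := B x x - 2 * phi x.

Let JD x y : J (x + y) = J x + 2 * (B x y - phi y) + B y y.
Proof. by rewrite /J phiD !(BD, BDr) (Bsym y x); ring. Qed.

Let J_lbound x : - (D ^+ 2 / c) <= J x.
Proof.
have := Bcoercive x; have := phi_bounded x; rewrite ler_norml => /andP[_ Dx] cx.
rewrite /J -subr_ge0 -(pmulr_rge0 _ c0).
have -> : c * (B x x - 2 * phi x - - (D ^+ 2 / c)) =
    c * (B x x - 2 * phi x) + D ^+ 2 by field; rewrite gt_eqF.
apply: (@le_trans _ _ ((c * `|x| - D) ^+ 2)); first exact: sqr_ge0.
rewrite (_ : (c * `|x| - D) ^+ 2 = c * (c * `|x| ^+ 2 - 2 * (D * `|x|)) + D ^+ 2).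
  rewrite lerD2r ler_pM2l//; lra.
ring.
Qed.

Let I := inf (range J).

Let sublevel e := [set x | J x < I + e].

Let hasinfJ : has_inf (range J).
Proof.
split; first by exists (J 0), 0.
by exists (- (D ^+ 2 / c)) => _ [x _ <-]; exact: J_lbound.
Qed.

Let J_ge x : I <= J x.
Proof. by apply: ge_inf; [exact: hasinfJ.2|exists x]. Qed.

Let G : set_system V := filter_from [set e | 0 < e] sublevel.

Let G_proper : ProperFilter G.
Proof.
apply: filter_from_proper.
  apply: filter_from_filter; first by exists 1; rewrite /= ltr01.
  move=> e1 e2 /= e10 e20; exists (Num.min e1 e2); first by rewrite /= lt_min e10.
  by move=> x; rewrite /sublevel /= => H; split;
    apply: (lt_le_trans H); rewrite lerD2l ge_min lexx ?orbT.
move=> e /= e0; have [_ [x _ <-] H] := inf_adherent e0 hasinfJ.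
by exists x.
Qed.

Let sublevel_small e x y : sublevel e x -> sublevel e y ->
  c * `|x - y| ^+ 2 <= 4 * e.
Proof.
rewrite /sublevel /= => ex ey; apply: (le_trans (Bcoercive _)).
(* by the parallelogram identity, J falls short of its mean at the midpoint *)
have : J x + J y - 2 * J (2^-1 *: (x + y)) = 2^-1 * B (x - y) (x - y).
  by rewrite /J phiZ phiD -(scaleN1r y) !(BZ, BZr, BD, BDr) (Bsym y x); field.
have := J_ge (2^-1 *: (x + y)); lra.
Qed.

Let G_cvg : cvg G.
Proof.
have FG := G_proper; apply: cauchy_cvg; apply: cauchy_exP => e /= e0.
have d0 : 0 < c * e ^+ 2 / 8 by rewrite divr_gt0 ?mulr_gt0 ?exprn_gt0.
have [_ [x _ <-] xd] := inf_adherent d0 hasinfJ.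
exists x; exists (c * e ^+ 2 / 8) => // y yd.
have H := sublevel_small xd yd.
rewrite -ball_normE /=.
rewrite -(@ltr_pXn2r _ 2)// ?nnegrE ?(ltW e0)// -(ltr_pM2l c0).
apply: (le_lt_trans H); have : 0 < c * e ^+ 2 by rewrite mulr_gt0 ?exprn_gt0.
lra.
Qed.

(** B(x, .) - phi is half the first variation at x of the strictly convex
    functional B(x, x) - 2 phi(x); coercivity and the parallelogram identity make its
    minimising sublevel sets Cauchy, and the variation vanishes at their limit. *)
Lemma symmetric_lax_milgram : exists g, forall v, B g v = phi v.
Proof.
have FG := G_proper.
have Glim e : 0 < e -> G [set x | `|lim G - x| < e].
  by move=> e0; have := G_cvg (nbhsx_ballx (lim G) e e0); rewrite -ball_normE.
exists (lim G) => v; apply/eqP; rewrite -subr_eq0 -normr_le0.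
apply/ler_addgt0Pl => eta eta0; rewrite addr0.
have C0 : 0 <= C * `|v|.
  have [->|v0] := eqVneq v 0; first by rewrite normr0 mulr0.
  have := le_trans (normr_ge0 _) (Bbounded v v).
  by rewrite -mulrA pmulr_lge0 ?mulr_gt0 ?normr_gt0// => ?; rewrite mulr_ge0.
pose b := C * `|v| * `|v| + 1.
have b0 : 0 < b by rewrite ltr_wpDl// mulr_ge0.
have e0 : 0 < eta ^+ 2 / (4 * b) by rewrite divr_gt0 ?mulr_gt0 ?exprn_gt0.
have k0 : 0 < eta / (2 * (C * `|v| + 1)).
  by rewrite divr_gt0 ?mulr_gt0// ltr_wpDl.
have GS : G (sublevel (eta ^+ 2 / (4 * b))) by exists (eta ^+ 2 / (4 * b)).
have [x [/= xd xS]] := filter_ex (filterI (Glim _ k0) GS).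
have disc : (phi v - B x v) ^+ 2 <= eta ^+ 2 / (4 * b) * b.
  apply: quadratic_discriminant => // t.
  have := J_ge (x + t *: v); rewrite JD phiZ !(BZ, BZr).
  move: xS; rewrite /sublevel /= => xS Jx.
  have : t ^+ 2 * B v v <= t ^+ 2 * b.
    rewrite ler_wpM2l ?sqr_ge0// /b; have := Bbounded v v.
    by move/(le_trans (ler_norm _)); lra.
  lra.
have {}disc : `|phi v - B x v| <= eta / 2.
  rewrite -(@ler_pXn2r _ 2)// ?nnegrE ?divr_ge0 ?(ltW eta0)//.
  rewrite real_normK ?num_real//; apply: (le_trans disc).
  by rewrite le_eqVlt; apply/orP; left; apply/eqP; field; rewrite gt_eqF.
have -> : B (lim G) v - phi v = B (lim G - x) v - (phi v - B x v).
  by rewrite BD -(scaleN1r x) BZ; ring.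
apply: (le_trans (ler_normB _ _)).
have : `|B (lim G - x) v| <= eta / 2.
  apply: (le_trans (Bbounded _ _)).
  apply: (@le_trans _ _ ((C * `|v| + 1) * `|lim G - x|)).
    rewrite mulrDl mul1r -mulrA (mulrC _ `|v|) mulrA lerDl //.
  rewrite mulrC -ler_pdivlMr ?ltr_wpDl//; apply: (le_trans (ltW xd)).
  rewrite le_eqVlt; apply/orP; left; apply/eqP; field.
  by rewrite gt_eqF// ltr_wpDl.
lra.
Qed.

End LaxMilgram.

(** * Adjoints, Gram operators and operator norms *)

Lemma continuous_linear_le (R : realType) (V W : normedModType R)
    (f : {linear V -> W}) : continuous f ->
  exists2 D, 0 <= D & forall x, `|f x| <= D * `|x|.
Proof.
move=> cf; have : bounded_near f (nbhs (0 : V)).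
  exact: continuous_linear_bounded (cf _).
move=> /linear_boundedP fb.
have [D [/= D0 fD]] := filter_ex (filterI (nbhs_pinfty_ge (num_real (0 : R))) fb).
by exists D.
Qed.

Section Riesz.
Context {R : realType} {V : hilbertType R}.

Lemma dot_riesz (phi : {linear V -> R}) : continuous phi ->
  forall v, dot (riesz phi) v = phi v.
Proof.
move=> cphi; have [D _ phiD] := continuous_linear_le cphi.
have [g gphi] : exists g, forall v, dot g v = phi v.
  apply: (@symmetric_lax_milgram R V dot phi 1 1 D).
  - exact: dotC.
  - exact: dotDl.
  - exact: dotZl.
  - exact: ltr01.
  - by move=> x; rewrite mul1r dotxx.
  - by move=> x y; rewrite mul1r; exact: normr_dot_le.
  - exact: linearD.
  - by move=> a x; rewrite linearZ.
  - exact: phiD.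
by rewrite (rieszP gphi).
Qed.

Lemma dot_gradient (f : V -> R) x : differentiable f x ->
  forall v, dot (gradient f x) v = 'd f x v.
Proof. by move=> df; apply: dot_riesz => y; exact: diff_continuous. Qed.

End Riesz.

Section Adjoint.
Context {R : realType} {V W : hilbertType R}.
Implicit Types (A B : {linear V -> W}) (y z : W).

Lemma dot_adjoint A y x : continuous A -> dot (adjoint A y) x = dot y (A x).
Proof.
move=> cA.
have lin : linear (fun x => dot y (A x)).
  by move=> a u v; rewrite linearP dotDr dotZr.
pose phi : {linear V -> R} :=
  HB.pack (fun x => dot y (A x)) (GRing.isLinear.Build _ _ _ _ _ lin).
rewrite [adjoint A y](_ : _ = riesz phi)// dot_riesz// => u.
by apply: cvg_dot; [exact: cvg_cst|exact: cA].
Qed.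

Lemma adjointD A y z : continuous A ->
  adjoint A (y + z) = adjoint A y + adjoint A z.
Proof. by move=> cA; apply: dot_inj => v; rewrite dotDl !dot_adjoint// dotDl. Qed.

Lemma adjointZ A a y : continuous A -> adjoint A (a *: y) = a *: adjoint A y.
Proof. by move=> cA; apply: dot_inj => v; rewrite dotZl !dot_adjoint// dotZl. Qed.

Lemma adjointB A y z : continuous A ->
  adjoint A (y - z) = adjoint A y - adjoint A z.
Proof. by move=> cA; rewrite -scaleN1r adjointD// adjointZ// scaleN1r. Qed.

(** Passing to adjoints preserves operator-norm bounds because
    |B^T y|^2 = <y, B B^T y>; here this is used for a difference of operators. *)
Lemma norm_adjointB_le A B c y : continuous A -> continuous B -> 0 <= c ->
  (forall x, `|A x - B x| <= c * `|x|) ->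
  `|adjoint A y - adjoint B y| <= c * `|y|.
Proof.
move=> cA cB c0 cAB; set d := adjoint A y - adjoint B y.
have [->|d0] := eqVneq d 0; first by rewrite normr0 mulr_ge0.
rewrite -(@ler_pM2r _ `|d|) ?normr_gt0// -expr2 -dotxx {1}/d dotBl.
rewrite !dot_adjoint// -dotBr (le_trans (dot_le _ _))//.
by rewrite mulrAC mulrC ler_wpM2r.
Qed.

Lemma norm_adjoint_le A c y : continuous A -> 0 <= c ->
  (forall x, `|A x| <= c * `|x|) -> `|adjoint A y| <= c * `|y|.
Proof.
move=> cA c0 cAx; set d := adjoint A y.
have [->|d0] := eqVneq d 0; first by rewrite normr0 mulr_ge0.
rewrite -(@ler_pM2r _ `|d|) ?normr_gt0// -expr2 -dotxx {1}/d.
rewrite !dot_adjoint// (le_trans (dot_le _ _))//.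
by rewrite mulrAC mulrC ler_wpM2r.
Qed.

End Adjoint.

(** An operator whose adjoint is bounded below has an invertible Gram operator
    A A^T; for the inner product <., S .> given by its inverse S, the linearised
    output flow is an ordinary gradient flow. *)
Section GramInverse.
Context {R : realType} {V W : hilbertType R}.
Variables (A : {linear V -> W}) (s K : R).
Hypothesis cA : continuous A.
Hypothesis s0 : 0 < s.
Hypothesis K0 : 0 <= K.
Hypothesis AK : forall x, `|A x| <= K * `|x|.
Hypothesis As : forall y, s * `|y| <= `|adjoint A y|.

Lemma gram_inverse_exists : exists S : W -> W,
  forall y z, dot (adjoint A (S y)) (adjoint A z) = dot y z.
Proof.
suff H y : exists g, forall z, dot (adjoint A g) (adjoint A z) = dot y z.
  by have [S HS] := choice H; exists S.
apply: (@symmetric_lax_milgram R W (fun x z => dot (adjoint A x) (adjoint A z))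
  (dot y) (s ^+ 2) (K ^+ 2) `|y|).
- by move=> u v; exact: dotC.
- by move=> u v w; rewrite adjointD// dotDl.
- by move=> a u v; rewrite adjointZ// dotZl.
- by rewrite exprn_gt0.
- by move=> x; rewrite dotxx -exprMn lerXn2r// ?nnegrE ?mulr_ge0 ?(ltW s0)//.
- move=> u v; rewrite (le_trans (normr_dot_le _ _))//.
  by rewrite expr2 -mulrA mulrACA ler_pM// norm_adjoint_le.
- by move=> u v; rewrite dotDr.
- by move=> a u; rewrite dotZr.
- by move=> u; exact: normr_dot_le.
Qed.

Variable S : W -> W.
Hypothesis SP : forall y z, dot (adjoint A (S y)) (adjoint A z) = dot y z.

Lemma gram_inverse_sym y z : dot (S y) z = dot y (S z).
Proof. by rewrite dotC -SP dotC SP. Qed.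

Lemma gram_inverseB y z : S (y - z) = S y - S z.
Proof. by apply: dot_inj => u; rewrite dotBl !gram_inverse_sym dotBl. Qed.

Lemma gram_inverseZ b y : S (b *: y) = b *: S y.
Proof. by apply: dot_inj => u; rewrite dotZl !gram_inverse_sym dotZl. Qed.

Lemma gram_inverse_le y : `|S y| <= `|y| / s ^+ 2.
Proof.
rewrite ler_pdivlMr ?exprn_gt0//.
have [->|Sy0] := eqVneq `|S y| 0; first by rewrite mul0r.
have Sy : 0 < `|S y| by rewrite lt_def Sy0 /=.
rewrite -(@ler_pM2r _ `|S y|)// (@le_trans _ _ (dot y (S y)))//; last exact: dot_le.
rewrite -SP dotxx (_ : _ * _ * _ = (s * `|S y|) ^+ 2); last by rewrite exprMn; ring.
by rewrite lerXn2r// ?nnegrE ?mulr_ge0 ?(ltW s0)//.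
Qed.

Lemma norm_le_gram_inverse y : `|y| ^+ 2 <= K ^+ 2 * dot y (S y).
Proof.
rewrite -SP dotxx.
have [->|y0] := eqVneq `|y| 0; first by rewrite expr0n/= mulr_ge0 ?sqr_ge0.
have {}y0 : 0 < `|y| by rewrite lt_def y0 /=.
rewrite -exprMn lerXn2r// ?nnegrE ?mulr_ge0//.
rewrite -(@ler_pM2r _ `|y|)// -expr2 -dotxx -SP (le_trans (dot_le _ _))//.
by rewrite (mulrC K) -mulrA ler_wpM2l// norm_adjoint_le.
Qed.

End GramInverse.

Section OperatorNorm.
Context {R : realType} {V W : normedModType R}.

Lemma le_opnorm (f : V -> W) D : (forall a x, f (a *: x) = a *: f x) ->
  (forall x, `|f x| <= D * `|x|) -> forall x, `|f x| <= opnorm f * `|x|.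
Proof.
move=> fZ fD x; have [->|x0] := eqVneq x 0.
  by rewrite (le_trans (fD _))// normr0 !mulr0.
rewrite -ler_pdivrMr ?normr_gt0//; apply: ub_le_sup.
  exists `|D| => _ [y /= y1 <-]; apply: (le_trans (fD _)).
  apply: (le_trans (ler_wpM2r (normr_ge0 _) (ler_norm D))).
  by rewrite -[leRHS]mulr1 ler_wpM2l.
exists (`|x|^-1 *: x); first by rewrite /= normrZ normfV normr_id mulVf ?normr_eq0.
by rewrite fZ normrZ normfV normr_id mulrC.
Qed.

Lemma le_opnorm_linear (f : {linear V -> W}) : continuous f ->
  forall x, `|f x| <= opnorm f * `|x|.
Proof.
move=> /continuous_linear_le[D _ fD]; apply: le_opnorm fD => a x.
by rewrite linearZ.
Qed.

Lemma smallest_singular_value_le (B : W -> V) v :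
  smallest_singular_value B * `|v| <= `|B v|.
Proof.
have [->|v0] := eqVneq v 0; first by rewrite normr0 mulr0.
rewrite -ler_pdivlMr ?normr_gt0//; apply: ge_sup.
  by exists 0 => u /=; rewrite mul0r.
by move=> s /= sB; rewrite ler_pdivlMr ?normr_gt0.
Qed.

Lemma lip_diff_ge0 (h : V -> W) : has_lipschitz_diff h -> 0 <= lip_diff h.
Proof. by move=> [_ h0]; apply: lb_le_inf => // L []. Qed.

Lemma lip_diff_le (h : V -> W) : has_lipschitz_diff h ->
  forall x y v, `|'d h x v - 'd h y v| <= lip_diff h * `|x - y| * `|v|.
Proof.
move=> [dh h0] x y v.
pose f v := 'd h x v - 'd h y v.
have fop : `|f v| <= opnorm f * `|v|.
  have [D1 _ H1] := continuous_linear_le (diff_continuous (dh x)).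
  have [D2 _ H2] := continuous_linear_le (diff_continuous (dh y)).
  apply: (@le_opnorm _ (D1 + D2)) => [a u|u].
    by rewrite /f !linearZ /= scalerDr scalerN.
  by rewrite mulrDl (le_trans (ler_normB _ _))// lerD.
apply: (le_trans fop); rewrite ler_wpM2r//.
rewrite {fop}/f; have [->|xy] := eqVneq x y.
  by have [L [_ /(_ y y)]] := h0; rewrite subrr normr0 !mulr0.
rewrite -ler_pdivrMr ?normr_gt0 ?subr_eq0//; apply: lb_le_inf => // L [_ HL].
by rewrite ler_pdivrMr ?normr_gt0 ?subr_eq0.
Qed.

End OperatorNorm.

(** * Differential calculus along curves *)

Section Curves.
Context {R : realType}.

Lemma is_derive1P (V : normedModType R) (u : R -> V) (t : R) (du : V) :
  is_derive t 1 u du <->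
  (fun e => e^-1 *: (u (t + e) - u t)) @ 0^' --> du.
Proof.
have E : (fun e : R => e^-1 *: ((u \o shift t) (e *: 1) - u t)) =
    (fun e => e^-1 *: (u (t + e) - u t)).
  by apply/funext => e /=; rewrite [e *: 1]mulr1 (addrC e).
split=> [[du1 <-]|H].
  by rewrite -E; exact: du1.
have d : derivable u t 1 by apply/cvg_ex; exists du; rewrite E.
split=> //; by rewrite /derive E; exact: cvg_lim H.
Qed.

Lemma is_derive_cvg (V : normedModType R) (u : R -> V) (t : R) (du : V) :
  is_derive t 1 u du -> u s @[s --> t] --> u t.
Proof.
by move=> [/derivable1_diffP/differentiable_continuous].
Qed.

Lemma is_derive_chain (V W : normedModType R) (f : V -> W) (u : R -> V) (t : R) (du : V) :
  differentiable f (u t) -> is_derive t 1 u du ->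
  is_derive t 1 (f \o u) ('d f (u t) du).
Proof.
move=> df [/derivable1_diffP u' <-].
have fu' : differentiable (f \o u) t by exact: differentiable_comp.
split; first exact/derivable1_diffP.
by rewrite !deriveE// diff_comp.
Qed.

Lemma is_derive_dot (V : hilbertType R) (u v : R -> V) (t : R) (du dv : V) :
  is_derive t 1 u du -> is_derive t 1 v dv ->
  is_derive t 1 (fun s => dot (u s) (v s)) (dot du (v t) + dot (u t) dv).
Proof.
move=> u' v'; apply/is_derive1P.
have -> : (fun e => e^-1 *: (dot (u (t + e)) (v (t + e)) - dot (u t) (v t))) =
    (fun e => dot (e^-1 *: (u (t + e) - u t)) (v (t + e)) +
              dot (u t) (e^-1 *: (v (t + e) - v t))).
  apply/funext => e; rewrite dotZl dotZr dotBl dotBr /GRing.scale /=; ring.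
have c : v (t + e) @[e --> 0^'] --> v t.
  have ct : t + e @[e --> (0 : R)] --> t + 0.
    by apply: cvgD; [exact: cvg_cst|exact: cvg_id].
  rewrite addr0 in ct; apply: cvg_within_filter.
  by move: ct (is_derive_cvg v'); exact: cvg_comp.
apply: cvgD; apply: cvg_dot; [exact/is_derive1P|exact: c|exact: cvg_cst|].
exact/is_derive1P.
Qed.

Lemma is_derive_bounded_linear (V W : normedModType R) (S : V -> W) (C : R)
    (u : R -> V) (t : R) (du : V) :
  (forall a x, S (a *: x) = a *: S x) -> (forall x y, S (x - y) = S x - S y) ->
  (forall x, `|S x| <= C * `|x|) ->
  is_derive t 1 u du -> is_derive t 1 (S \o u) (S du).
Proof.
move=> SZ SB SC; have lin : linear S.
  have SN x : S (- x) = - S x by rewrite -scaleN1r SZ scaleN1r.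
  by move=> a x y; rewrite -[y in LHS]opprK SB SZ SN opprK.
pose L : {linear V -> W} := HB.pack S (GRing.isLinear.Build _ _ _ _ _ lin).
have cL : continuous L.
  apply: bounded_linear_continuous; apply/linear_boundedP.
  apply: filterS (nbhs_pinfty_ge (num_real C)) => r /= Cr x.
  by rewrite (le_trans (SC x))// ler_wpM2r.
have dL : differentiable L (u t) by exact: linear_differentiable.
by move=> /(is_derive_chain dL); rewrite diff_lin.
Qed.

Lemma is_derive_nincr (f f' : R -> R) (a b : R) : a <= b ->
  (forall t, a <= t <= b -> is_derive t 1 f (f' t)) ->
  (forall t, a < t < b -> f' t <= 0) -> f b <= f a.
Proof.
rewrite le_eqVlt => /orP[/eqP -> //|ab] df f'0.
have cf : {within `[a, b], continuous f}.
  apply: derivable_within_continuous => x; rewrite in_itv /= => /df [].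
  by [].
have dfo x : x \in `]a, b[%R -> is_derive x 1 f (f' x).
  by rewrite in_itv /= => /andP[ax xb]; apply: df; rewrite !ltW.
have [c] := MVT ab dfo cf; rewrite in_itv /= => cab E.
by rewrite -subr_le0 E mulr_le0_ge0 ?f'0// subr_ge0 ltW.
Qed.

(** Mean value inequality for curves: pairing with the chord u(b) - u(a)
    reduces it to the monotonicity of a real function. *)
Lemma is_derive_norm_le (V : hilbertType R) (u u' : R -> V) (g g' : R -> R) (a b : R) :
  a <= b ->
  (forall t, a <= t <= b -> is_derive t 1 u (u' t)) ->
  (forall t, a <= t <= b -> is_derive t 1 g (g' t)) ->
  (forall t, a < t < b -> `|u' t| <= g' t) ->
  `|u b - u a| <= g b - g a.
Proof.
move=> ab du dg ug; set c := u b - u a.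
have gab : 0 <= g b - g a.
  rewrite subr_ge0 -lerN2.
  apply: (@is_derive_nincr (fun t => - g t) (fun t => - g' t)) => // t tab.
    by apply: is_deriveN; exact: dg.
  by rewrite oppr_le0 (le_trans _ (ug _ tab)).
have [->|c0] := eqVneq c 0; first by rewrite normr0.
have : dot c (u b) - `|c| * g b <= dot c (u a) - `|c| * g a.
  apply: (@is_derive_nincr (fun t => dot c (u t) - `|c| * g t)
    (fun t => dot 0 (u t) + dot c (u' t) - `|c| * g' t)) => // t tab.
    apply: is_deriveB; first by apply: is_derive_dot; exact: du.
    exact: (is_deriveZ `|c| (dg t tab)).
  rewrite dotC -(scale0r c) dotZr mul0r add0r subr_le0 (le_trans (dot_le _ _))//.
  by rewrite ler_wpM2l// ug.
move=> H; rewrite -(@ler_pM2l _ `|c|) ?normr_gt0// -expr2 -dotxx {2}/c dotBr; lra.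
Qed.

(** Continuous induction: a bound that is reproduced strictly cannot fail at a
    first time, because just after the infimum of failures it would still hold. *)
Lemma continuous_induction (g : R -> R) (r : R) :
  (forall t : R, 0 <= t -> g s @[s --> t] --> g t) ->
  (forall T : R, 0 <= T -> (forall s, 0 <= s < T -> g s <= r) -> g T < r) ->
  forall t : R, 0 <= t -> g t < r.
Proof.
move=> cg step t t0; rewrite ltNge; apply/negP => rt.
pose A := [set s | 0 <= s /\ r <= g s].
have Ainf : has_inf A by split; [exists t|exists 0 => s []].
set T := inf A.
have T0 : 0 <= T by apply: lb_le_inf => [|s []//]; exact: Ainf.1.
have gT : g T < r.
  apply: step => // s /andP[s0 sT]; rewrite leNgt; apply/negP => /ltW rs.
  by move: sT; rewrite ltNge => /negP; apply; apply: ge_inf => //; exact: Ainf.2.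
have /cvgrPdist_lt /= /(_ (r - g T)) := cg T T0.
rewrite subr_gt0 => /(_ gT) [e /= e0 He].
have [s [s0 rs] sT] := inf_adherent e0 Ainf.
have Ts : T <= s by apply: ge_inf => //; exact: Ainf.2.
have : ball T e s.
  by rewrite /ball /= ler0_norm ?subr_le0// opprB ltrBlDl.
move/He; rewrite ltr_norml => /andP[+ _].
by rewrite ltrBrDl; lra.
Qed.

(** A solution given on [0, +oo) with a one-sided derivative at 0 is the
    restriction of a curve with genuine derivatives at every t >= 0: continue it
    by its tangent line. *)
Lemma extend_one_sided (V : normedModType R) (w w' : R -> V) :
  (forall t : R, 0 <= t ->
    (s - t)^-1 *: (w s - w t) @[s --> within [set s | 0 <= s] t^'] --> w' t) ->
  exists2 u : R -> V, (forall t : R, 0 <= t -> u t = w t) &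
    forall t : R, 0 <= t -> is_derive t 1 u (w' t).
Proof.
move=> dw; pose u t := if 0 <= t then w t else w 0 + t *: w' 0.
have uE t : 0 <= t -> u t = w t by rewrite /u => ->.
exists u => // t t0; apply/is_derive1P/cvgrPdist_lt => e e0.
have /cvgrPdist_lt /(_ e e0) [d /= d0 Hd] := dw t t0.
(* for t > 0 a radius below t keeps away from the extension *)
pose d' := if t == 0 then d else Num.min d t.
have d'0 : 0 < d'.
  rewrite /d'; case: ifPn => // t1; rewrite lt_min d0 lt_def t1 t0 //.
exists d' => // s /=; rewrite sub0r normrN => sd s0.
have sd1 : `|s| < d.
  by apply: (lt_le_trans sd); rewrite /d'; case: ifPn => // _; rewrite ge_min lexx.
have [ts|ts] := leP 0 (t + s).
  have := Hd (t + s); rewrite /= opprD addrA subrr sub0r normrN => /(_ sd1).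
  have E : t + s - t = s by rewrite addrC addKr.
  rewrite E => H; rewrite !uE//; apply: H => //.
  by rewrite /= -subr_eq0 E.
have tz : t = 0.
  apply/eqP; apply/negPn/negP => t1; move: sd.
  rewrite /d' (negbTE t1) lt_min => /andP[_]; rewrite ltr_norml => /andP[+ _].
  by move: ts; lra.
subst t; rewrite add0r in ts *; rewrite {1}/u leNgt ts /= uE//.
by rewrite (addrC (w 0)) addrK scalerA mulVf// scale1r subrr normr0.
Qed.

End Curves.

(** * Smooth strongly convex functions *)

Section Loss.
Context {R : realType} {V : hilbertType R}.
Variables (f : V -> R) (M m : R) (xmin : V).
Hypothesis fsmooth : smooth M f.
Hypothesis fconvex : strongly_convex m f.
Hypothesis fmin : forall x, f xmin <= f x.

Implicit Types x y v : V.

Let df x : differentiable f x := fsmooth.1 x.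
Let m0 : 0 < m := fconvex.1.

Lemma gradient_lipschitz x y : `|gradient f x - gradient f y| <= M * `|x - y|.
Proof. by have := fsmooth.2 (x, y); apply. Qed.

Lemma is_derive_line (x v : V) (t : R) : is_derive t 1 (fun s : R => x + s *: v) v.
Proof.
rewrite -[v in is_derive _ _ _ v]add0r; apply: is_deriveD.
have d : differentiable (fun s : R => s *: v) t by [].
split; first exact/derivable1_diffP.
by rewrite deriveE// diff_val scale1r.
Qed.

Lemma is_derive_along_line (x v : V) (t : R) :
  is_derive t 1 (fun s : R => f (x + s *: v)) (dot (gradient f (x + t *: v)) v).
Proof.
rewrite dot_gradient//.
exact: (is_derive_chain (df (x + t *: v)) (is_derive_line x v t)).
Qed.

Lemma is_derive_quadratic (k c t : R) :
  is_derive t 1 (fun t => k * t + c * t ^+ 2) (k + c * (2 * t)).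
Proof.
have -> : (fun t => k * t + c * t ^+ 2) = k \*: (@id R) + c \*: (@id R) ^+ 2.
  by apply/funext => s; rewrite exprfctE.
by apply: is_derive_eq; rewrite /GRing.scale /= expr1; ring.
Qed.

Lemma is_derive_at_max_le0 (g : R -> R) (d : R) : is_derive (0 : R) 1 g d ->
  (forall t, 0 <= t <= 1 -> g t <= g 0) -> d <= 0.
Proof.
move=> /is_derive1P /cvgrPdist_lt H gt; rewrite leNgt; apply/negP => d0.
have [e /= e0 He] := H _ d0.
pose s := Num.min (e / 2) 1.
have s0 : 0 < s by rewrite lt_min divr_gt0//=.
have s1 : s <= 1 by rewrite ge_min lexx orbT.
have se : s < e by rewrite gt_min (_ : e / 2 < e)//; lra.
have := He s; rewrite /= sub0r normrN gtr0_norm// => /(_ se).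
rewrite gt_eqF// => /(_ isT); rewrite add0r ltr_norml => /andP[_].
rewrite ltrBlDr ltrDl => q; have := gt s; rewrite (ltW s0) s1 => /(_ isT).
rewrite -subr_le0 leNgt => /negP; apply.
by rewrite -(pmulr_rgt0 _ (_ : 0 < s^-1))// invr_gt0.
Qed.

(** Strong convexity says that f on the segment from y to x, minus a quadratic,
    is largest at y; its derivative there is therefore nonpositive. *)
Lemma strongly_convex_gradient x y :
  f y + dot (gradient f y) (x - y) + m / 2 * `|x - y| ^+ 2 <= f x.
Proof.
set v := x - y; pose k := f x - f y - m / 2 * `|v| ^+ 2.
pose g := fun t : R => f (y + t *: v) - (k * t + m / 2 * `|v| ^+ 2 * t ^+ 2).
have dg : is_derive (0 : R) 1 g (dot (gradient f (y + 0 *: v)) v -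
    (k + m / 2 * `|v| ^+ 2 * (2 * 0))).
  by apply: is_deriveB; [exact: is_derive_along_line|exact: is_derive_quadratic].
have := is_derive_at_max_le0 dg; rewrite scale0r addr0.
have -> : g 0 = f y by rewrite /g scale0r addr0 expr0n /=; ring.
move=> H; suff : dot (gradient f y) v - (k + m / 2 * `|v| ^+ 2 * (2 * 0)) <= 0.
  rewrite /k; lra.
apply: H => t t01.
have := fconvex.2 x y t t01.
have -> : t *: x + (1 - t) *: y = y + t *: v.
  by rewrite /v scalerBl scale1r scalerBr addrCA.
rewrite /g /k -/v; lra.
Qed.

Lemma gradient_strongly_monotone x y :
  m * `|x - y| ^+ 2 <= dot (gradient f x - gradient f y) (x - y).
Proof.
have := strongly_convex_gradient x y; have := strongly_convex_gradient y x.
rewrite dotBl -(opprB x y) normrN dotNr; lra.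
Qed.

(** The descent lemma: along t |-> x + t v the difference of the two sides has
    derivative <grad f(x + t v) - grad f(x), v> - M t |v|^2 <= 0. *)
Lemma smooth_upper_bound x v :
  f (x + v) <= f x + dot (gradient f x) v + M / 2 * `|v| ^+ 2.
Proof.
pose k := dot (gradient f x) v.
pose g := fun t : R => f (x + t *: v) - (k * t + M / 2 * `|v| ^+ 2 * t ^+ 2).
have dg (t : R) : is_derive t 1 g (dot (gradient f (x + t *: v)) v -
    (k + M / 2 * `|v| ^+ 2 * (2 * t))).
  by apply: is_deriveB; [exact: is_derive_along_line|exact: is_derive_quadratic].
have : g 1 <= g 0.
  apply: (@is_derive_nincr R g _ 0 1) => // t /andP[t0 _].
  have := dot_le (gradient f (x + t *: v) - gradient f x) v.
  rewrite dotBl -/k.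
  have := ler_wpM2r (normr_ge0 v) (gradient_lipschitz (x + t *: v) x).
  rewrite addrAC subrr add0r normrZ gtr0_norm// expr2; lra.
rewrite /g scale0r scale1r addr0 expr1n expr0n /= /k; lra.
Qed.

Lemma gradient_min : gradient f xmin = 0.
Proof.
have H v : 0 <= dot (gradient f xmin) v.
  have := is_deriveN (is_derive_along_line xmin v 0).
  move/is_derive_at_max_le0; rewrite oppr_le0 scale0r addr0; apply => t _ /=.
  by rewrite lerN2 scale0r addr0.
apply/eqP; rewrite -normr_eq0 -sqrf_eq0 eq_le sqr_ge0 andbT.
by rewrite -dotxx -oppr_ge0 -dotNr.
Qed.

Lemma modulus_le_smoothness x : x != 0 -> m <= M.
Proof.
move=> x0; have x2 : 0 < `|x| ^+ 2 by rewrite exprn_gt0// normr_gt0.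
have := gradient_strongly_monotone x 0; have := dot_le (gradient f x - gradient f 0) x.
have := ler_wpM2r (normr_ge0 x) (gradient_lipschitz x 0).
rewrite subr0 -mulrA -expr2 => a b c.
by rewrite -(ler_pM2r x2) (le_trans c) // (le_trans b).
Qed.

Lemma norm_gradient_le x : `|gradient f x| <= M * `|x - xmin|.
Proof. by have := gradient_lipschitz x xmin; rewrite gradient_min subr0. Qed.

Lemma excess_ge x : m / 2 * `|x - xmin| ^+ 2 <= f x - f xmin.
Proof.
have := strongly_convex_gradient x xmin.
by rewrite gradient_min -(scale0r 0) dotZl mul0r; lra.
Qed.

Lemma excess_le x : f x - f xmin <= M / 2 * `|x - xmin| ^+ 2.
Proof.
have := smooth_upper_bound xmin (x - xmin).
rewrite gradient_min -(scale0r 0) dotZl mul0r addrC subrK; lra.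
Qed.

(** The Polyak-Lojasiewicz inequality: minimise over x' the quadratic lower
    bound that strong convexity gives at x. *)
Lemma polyak_lojasiewicz x : 2 * m * (f x - f xmin) <= `|gradient f x| ^+ 2.
Proof.
have := strongly_convex_gradient xmin x.
have : 0 <= `|gradient f x + m *: (xmin - x)| ^+ 2 by exact: sqr_ge0.
rewrite normD_sqr dotZr normrZ gtr0_norm// exprMn => a b.
have := ler_wpM2l (ltW m0) b; rewrite expr2 in a; lra.
Qed.

End Loss.

(** * Convergence of the lazy flow *)

Lemma is_derive_expRM (R : realType) (c t : R) :
  is_derive t 1 (fun s => expR (c * s)) (c * expR (c * t)).
Proof.
have cid : is_derive t 1 (c \*: (@id R)) (c *: (1 : R)).
  exact: is_deriveZ.
have := is_derive1_comp (is_derive_expR (c * t)) cid.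
by rewrite [c *: 1]mulr1 mulrC.
Qed.

(** The constants L, K and s are bounds rather than the exact Lipschitz constant,
    norm and singular value, so that the linearisation of h satisfies the same
    hypotheses with L = 0 and unchanged K and s. *)
Record lazy_model (R : realType) (V F : hilbertType R) (h : V -> F)
    (loss : F -> R) (M m : R) (ystar : F) (w0 : V) (L K s : R) : Prop := LazyModel {
  lm_diff : forall x, differentiable h x;
  lm_L_ge0 : 0 <= L;
  lm_lip : forall x y v, `|'d h x v - 'd h y v| <= L * `|x - y| * `|v|;
  lm_K_ge0 : 0 <= K;
  lm_opnorm : forall v, `|'d h w0 v| <= K * `|v|;
  lm_s_gt0 : 0 < s;
  lm_singular : forall y, s * `|y| <= `|adjoint ('d h w0) y|;
  lm_s_le_K : s <= K;
  lm_smooth : smooth M loss;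
  lm_convex : strongly_convex m loss;
  lm_min : forall y, loss ystar <= loss y;
  lm_m_le_M : m <= M
}.

(** The last field says that the output of the initial weights, relative to the
    curvature of h, is so close to the minimiser that the weights cannot leave the
    ball on which the differential of h keeps half of its smallest singular value. *)
Record lazy_flow (R : realType) (V F : hilbertType R) (h : V -> F)
    (loss : F -> R) (M m : R) (ystar : F) (w0 : V) (L K s alpha : R)
    (w : R -> V) : Prop := LazyFlow {
  lf_model :> lazy_model h loss M m ystar w0 L K s;
  lf_alpha_gt0 : 0 < alpha;
  lf_start : w 0 = w0;
  lf_flow : forall t : R, 0 <= t -> is_derive t 1 w
    (- (alpha^-1 *: adjoint ('d h (w t)) (gradient loss (alpha *: h (w t)))));
  lf_close : 12 * (M / m) * Num.sqrt (M / m) * K * L * `|alpha *: h w0 - ystar|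
    < alpha * s ^+ 3
}.

Section LazyFlow.
Context {R : realType} {V F : hilbertType R}.
Variables (h : V -> F) (loss : F -> R) (M m : R) (ystar : F) (w0 : V).
Variables (L K s alpha : R) (w : R -> V).
Hypothesis H : lazy_flow h loss M m ystar w0 L K s alpha w.

Let y t := alpha *: h (w t).
Let r := `|alpha *: h w0 - ystar|.
Let a := m * s ^+ 2 / 4.
Let rho := 6 * (M / m) * Num.sqrt (M / m) * K * r / (alpha * s ^+ 2).

Let s0 := lm_s_gt0 H.
Let m0 : 0 < m := (lm_convex H).1.
Let M0 : 0 < M := lt_le_trans m0 (lm_m_le_M H).
Let K0 := lm_K_ge0 H.
Let L0 := lm_L_ge0 H.
Let al0 := lf_alpha_gt0 H.
Let a0 : 0 < a. Proof. by rewrite divr_gt0// mulr_gt0// exprn_gt0. Qed.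
Let r0 : 0 <= r. Proof. exact: normr_ge0. Qed.
Let kappa0 : 0 < M / m. Proof. by rewrite divr_gt0. Qed.
Let cd x : continuous ('d h x). Proof. exact: diff_continuous (lm_diff H x). Qed.

Lemma lazy_flow_output (t : R) : 0 <= t -> is_derive t 1 y
  (- 'd h (w t) (adjoint ('d h (w t)) (gradient loss (y t)))).
Proof.
move=> t0; apply: (is_derive_eq
  (is_deriveZ alpha (is_derive_chain (lm_diff H (w t)) (lf_flow H t0)))).
rewrite linearN linearZ /= scalerN scalerA mulfV ?scale1r//.
by rewrite gt_eqF.
Qed.

Lemma lazy_flow_loss (t : R) : 0 <= t -> is_derive t 1 (loss \o y)
  (- `|adjoint ('d h (w t)) (gradient loss (y t))| ^+ 2).
Proof.
move=> t0; apply: (is_derive_eq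
  (is_derive_chain ((lm_smooth H).1 (y t)) (lazy_flow_output t0))).
by rewrite -dot_gradient ?dotNr -?dot_adjoint ?dotxx//; exact: (lm_smooth H).1.
Qed.

(** Weyl's perturbation bound for singular values. *)
Lemma lazy_flow_singular t z : L * `|w t - w0| <= s / 2 ->
  s / 2 * `|z| <= `|adjoint ('d h (w t)) z|.
Proof.
move=> near_w0; rewrite distrC in near_w0.
have key (A B D x : R) :
    s * x <= A -> A - B <= D -> D <= s / 2 * x -> s / 2 * x <= B by lra.
apply: key (lm_singular H z) (lerB_dist _ _) _.
rewrite (le_trans (norm_adjointB_le z (@cd w0) (@cd (w t)) _ (lm_lip H w0 (w t))))//.
  by rewrite mulr_ge0.
by rewrite ler_wpM2r.
Qed.

Lemma lazy_flow_adjoint_le t z : L * `|w t - w0| <= s / 2 ->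
  `|adjoint ('d h (w t)) z| <= 3 / 2 * K * `|z|.
Proof.
move=> near_w0.
have key (A B D x : R) :
    B - A <= D -> A <= K * x -> D <= s / 2 * x -> s * x <= K * x ->
    B <= 3 / 2 * K * x by lra.
apply: key (lerB_dist _ _) (norm_adjoint_le z (@cd w0) K0 (lm_opnorm H)) _ _.
  rewrite (le_trans (norm_adjointB_le z (@cd (w t)) (@cd w0) _ (lm_lip H (w t) w0)))//.
    by rewrite mulr_ge0.
  by rewrite ler_wpM2r.
by rewrite ler_wpM2r// (lm_s_le_K H).
Qed.

(** While w stays in the tube, the Polyak-Lojasiewicz inequality and the lower
    bound s / 2 on the singular values give (loss - min)' <= - 2 a (loss - min). *)
Lemma lazy_flow_decay T : 0 <= T ->
  (forall t, 0 <= t < T -> L * `|w t - w0| <= s / 2) ->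
  `|y T - ystar| <= Num.sqrt (M / m) * r * expR (- a * T).
Proof.
move=> T0 tube.
have decr : (loss (y T) - loss ystar) * expR (2 * a * T) <=
    (loss (y 0) - loss ystar) * expR (2 * a * 0).
  pose f' t := (loss (y t) - loss ystar) * (2 * a * expR (2 * a * t)) +
     expR (2 * a * t) * (- `|adjoint ('d h (w t)) (gradient loss (y t))| ^+ 2 - 0).
  apply: (@is_derive_nincr R
    (fun t => (loss (y t) - loss ystar) * expR (2 * a * t)) f' 0 T)
    => // [t /andP[t0 _]|t /andP[t0 tT]].
    apply: (is_deriveM _ (is_derive_expRM (2 * a) t)).
    by apply: is_deriveB; exact: lazy_flow_loss.
  have tb : L * `|w t - w0| <= s / 2 by apply: tube; rewrite ltW.
  have PL := polyak_lojasiewicz ystar (lm_smooth H) (lm_convex H) (y t).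
  have sg := lazy_flow_singular (gradient loss (y t)) tb.
  have {}sg : (s / 2 * `|gradient loss (y t)|) ^+ 2 <=
      `|adjoint ('d h (w t)) (gradient loss (y t))| ^+ 2.
    by rewrite lerXn2r// ?nnegrE ?mulr_ge0 ?divr_ge0 ?(ltW s0).
  have key (e E g G : R) : 0 < e -> (s / 2 * g) ^+ 2 <= G -> 2 * m * E <= g ^+ 2 ->
      E * (2 * a * e) + e * (- G - 0) <= 0.
    move=> e0 gG Eg.
    rewrite [leLHS](_ : _ = - (e * (G - 2 * a * E))); last by rewrite subr0; ring.
    rewrite oppr_le0 mulr_ge0 ?(ltW e0)// subr_ge0; apply: le_trans gG.
    rewrite /a (_ : _ * E = (s / 2) ^+ 2 * (2 * m * E)); last by field.
    by rewrite [leRHS]exprMn ler_wpM2l ?sqr_ge0.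
  exact: key (expR_gt0 _) sg PL.
rewrite mulr0 expR0 mulr1 in decr.
have lo := excess_ge (lm_smooth H) (lm_convex H) (lm_min H) (y T).
have up := excess_le (lm_smooth H) (lm_min H) (y 0).
have E : expR (- a * T) ^+ 2 * expR (2 * a * T) = 1.
  by rewrite expr2 -!expRD -[RHS]expR0; congr expR; ring.
have e0 := expR_gt0 (2 * a * T).
rewrite -(@ler_pXn2r _ 2)// ?nnegrE ?mulr_ge0 ?sqrtr_ge0 ?expR_ge0//.
rewrite !exprMn sqr_sqrtr ?(ltW kappa0)//.
rewrite -(ler_pM2r e0) -[leRHS]mulrA E mulr1 -(ler_pM2l m0).
rewrite [leRHS](_ : _ = M * r ^+ 2); last by field; rewrite gt_eqF.
rewrite {2}/y (lf_start H) -/r in up.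
have key (X A B e x : R) : 0 < e -> m / 2 * x <= A -> A * e <= B -> B <= M / 2 * X ->
    m * (x * e) <= M * X.
  by move=> e0' /(ler_wpM2r (ltW e0')); lra.
exact: key e0 lo decr up.
Qed.

Lemma lazy_flow_gradient_le T : 0 <= T ->
  (forall t, 0 <= t < T -> L * `|w t - w0| <= s / 2) ->
  `|gradient loss (y T)| <= M * Num.sqrt (M / m) * r * expR (- a * T).
Proof.
move=> T0 tube; have := lazy_flow_decay T0 tube.
have := norm_gradient_le (lm_smooth H) (lm_min H) (y T).
move=> /le_trans G D; apply: G.
by rewrite -2!mulrA ler_pM2l// mulrA.
Qed.

(** In the tube the loss decays and the speed is at most G exp (- a t), whose integral
    over [0, +oo[ is rho = G / a. *)
Lemma lazy_flow_travel T : 0 <= T ->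
  (forall t, 0 <= t < T -> L * `|w t - w0| <= s / 2) ->
  `|w T - w0| <= rho.
Proof.
move=> T0 tube.
pose G := alpha^-1 * (3 / 2 * K) * (M * Num.sqrt (M / m) * r).
have G0 : 0 <= G by rewrite !mulr_ge0 ?invr_ge0 ?sqrtr_ge0 ?(ltW al0) ?(ltW M0).
have -> : rho = G / a.
  by rewrite /rho /G /a; field; rewrite !gt_eqF.
have : `|w T - w 0| <= - (G / a) * expR (- a * T) - - (G / a) * expR (- a * 0).
  apply: (@is_derive_norm_le R V w _ (fun t => - (G / a) * expR (- a * t))
    (fun t => - (G / a) * (- a * expR (- a * t))) 0 T) => //.
  - by move=> t /andP[t0 _]; exact: (lf_flow H t0).
  - by move=> t _; exact: (is_deriveZ (- (G / a)) (is_derive_expRM (- a) t)).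
  move=> t /andP[t0 tT].
  have tb : L * `|w t - w0| <= s / 2 by apply: tube; rewrite ltW.
  have tube' u : 0 <= u < t -> L * `|w u - w0| <= s / 2.
    by move=> /andP[u0 ut]; apply: tube; rewrite u0 (lt_trans ut).
  rewrite normrN normrZ gtr0_norm ?invr_gt0//.
  have g := lazy_flow_gradient_le (ltW t0) tube'.
  have K32 : 0 <= 3 / 2 * K by rewrite mulr_ge0.
  have := le_trans (lazy_flow_adjoint_le (gradient loss (y t)) tb)
    (ler_wpM2l K32 g).
  move=> /(ler_wpM2l (_ : 0 <= alpha^-1)) => /(_ _)/le_trans; apply.
    by rewrite invr_ge0 ltW.
  rewrite le_eqVlt; apply/orP; left; apply/eqP; rewrite /G.
  by field; rewrite !gt_eqF.
rewrite (lf_start H) mulr0 expR0.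
have := mulr_ge0 (divr_ge0 G0 (ltW a0)) (expR_ge0 (- a * T)); lra.
Qed.

Let tube_step : L * rho < s / 2.
Proof.
rewrite /rho mulrA ltr_pdivrMr ?mulr_gt0 ?exprn_gt0//.
have := lf_close H; rewrite -/r => c.
rewrite (_ : s / 2 * (alpha * s ^+ 2) = (alpha * s ^+ 3) / 2); last by ring.
by lra.
Qed.

(** Leaving the tube would take a path of length at least s / (2 L), but the
    exponentially decaying velocity only allows rho. *)
Lemma lazy_flow_in_tube t : 0 <= t -> L * `|w t - w0| <= s / 2.
Proof.
move=> t0; apply: ltW; move: t t0; apply: continuous_induction => [t t0|T T0 tube].
  apply: cvgM; first exact: cvg_cst.
  apply: cvg_norm; apply: cvgB; last exact: cvg_cst.
  exact: is_derive_cvg (lf_flow H t0).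
by apply: le_lt_trans tube_step; rewrite ler_wpM2l// lazy_flow_travel.
Qed.

Lemma lazy_flow_displacement t : 0 <= t -> `|w t - w0| <= rho.
Proof.
by move=> t0; apply: lazy_flow_travel => // u /andP[u0 _]; exact: lazy_flow_in_tube.
Qed.

Lemma lazy_flow_convergence t : 0 <= t ->
  `|y t - ystar| <= Num.sqrt (M / m) * r * expR (- a * t).
Proof.
by move=> t0; apply: lazy_flow_decay => // u /andP[u0 _]; exact: lazy_flow_in_tube.
Qed.

Lemma lazy_flow_gradient t : 0 <= t ->
  `|gradient loss (y t)| <= M * Num.sqrt (M / m) * r * expR (- a * t).
Proof.
move=> t0; apply: lazy_flow_gradient_le => // u /andP[u0 _].
exact: lazy_flow_in_tube.
Qed.

End LazyFlow.

(** * Comparison with the linearised flow *)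

Section Linearization.
Context {R : realType} {V W : normedModType R}.
Variables (h : V -> W) (w0 : V).
Hypothesis dh : differentiable h w0.

Lemma is_diff_linearization x : is_diff x (linearization h w0) ('d h w0).
Proof.
have d1 : is_diff x (id - cst w0) (id - 0) by apply: is_diffB.
have d2 : is_diff ((id - cst w0) x) ('d h w0) ('d h w0).
  have c : continuous ('d h w0) by exact: diff_continuous.
  by apply: DiffDef; [exact: linear_differentiable|exact: diff_lin].
have d3 := is_diffD (is_diff_cst (h w0) x) (is_diff_comp d1 d2).
apply: (is_diff_eq d3).
by apply/funext => v; rewrite /= add0r; congr ('d h w0 _); rewrite /= subr0.
Qed.

Lemma differentiable_linearization x : differentiable (linearization h w0) x.
Proof. by have [] := is_diff_linearization x. Qed.

Lemma diff_linearization x : 'd (linearization h w0) x = 'd h w0 :> (V -> W).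
Proof. by have [] := is_diff_linearization x. Qed.

Lemma linearization_center : linearization h w0 w0 = h w0.
Proof. by rewrite /linearization subrr linear0 addr0. Qed.

End Linearization.

(** The harmonic mean of X / b and Y / e controls their minimum. *)
Lemma le_harmonic (R : realFieldType) (x X Y b e : R) : 0 < b -> 0 < e ->
  0 <= X -> 0 <= Y -> x <= X / b -> x <= Y / e -> x <= (X + Y) * (2 / (b + e)).
Proof.
move=> b0 e0 X0 Y0 xX xY; have be : 0 < b + e by rewrite addr_gt0.
rewrite mulrA ler_pdivlMr//.
rewrite ler_pdivlMr// in xX; rewrite ler_pdivlMr// in xY.
lra.
Qed.

Section Comparison.
Context {R : realType} {V F : hilbertType R}.
Variables (h : V -> F) (loss : F -> R) (M m : R) (ystar : F) (w0 : V).
Variables (L K s alpha : R) (w wbar : R -> V).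
Let hbar := linearization h w0.
Hypothesis H : lazy_flow h loss M m ystar w0 L K s alpha w.
Hypothesis Hbar : lazy_flow hbar loss M m ystar w0 0 K s alpha wbar.

Let y t := alpha *: h (w t).
Let ybar t := alpha *: hbar (wbar t).
Let g t := gradient loss (y t).
Let gbar t := gradient loss (ybar t).
Let r := `|alpha *: h w0 - ystar|.
Let a := m * s ^+ 2 / 4.
Let rho := 6 * (M / m) * Num.sqrt (M / m) * K * r / (alpha * s ^+ 2).
Let G := M * Num.sqrt (M / m) * r.

Let s0 := lm_s_gt0 H.
Let m0 : 0 < m := (lm_convex H).1.
Let M0 : 0 < M := lt_le_trans m0 (lm_m_le_M H).
Let K0 := lm_K_ge0 H.
Let L0 := lm_L_ge0 H.
Let al0 := lf_alpha_gt0 H.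
Let a0 : 0 < a. Proof. by rewrite divr_gt0// mulr_gt0// exprn_gt0. Qed.
Let r0 : 0 <= r. Proof. exact: normr_ge0. Qed.
Let G0 : 0 <= G. Proof. by rewrite !mulr_ge0 ?sqrtr_ge0 ?(ltW M0). Qed.
Let rho0 : 0 <= rho.
Proof. by rewrite (le_trans _ (lazy_flow_displacement H (lexx 0))). Qed.
Let LK0 : 0 <= 5 / 2 * K * (L * rho).
Proof. by rewrite mulr_ge0 ?(mulr_ge0 L0 rho0)// mulr_ge0// divr_ge0. Qed.
Let cd x : continuous ('d h x). Proof. exact: diff_continuous (lm_diff H x). Qed.

Let adjoint_bar t : adjoint ('d hbar (wbar t)) = adjoint ('d h w0).
Proof. by rewrite (diff_linearization (lm_diff H w0)). Qed.

Let hbar0 : hbar w0 = h w0.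
Proof. exact: linearization_center. Qed.

(** The Gram operators A A^T of the flow and of its linearisation differ by the
    displacement of the weights. *)
Lemma gram_perturbation t v : 0 <= t ->
  `|'d h (w t) (adjoint ('d h (w t)) v) - 'd h w0 (adjoint ('d h w0) v)| <=
    5 / 2 * K * (L * rho) * `|v|.
Proof.
move=> t0.
have Lrho : L * `|w t - w0| <= L * rho.
  by rewrite ler_wpM2l//; exact: (lazy_flow_displacement H).
set p := adjoint ('d h (w t)) v; set q := adjoint ('d h w0) v.
have -> : 'd h (w t) p - 'd h w0 q = ('d h (w t) p - 'd h w0 p) + 'd h w0 (p - q).
  by rewrite linearB /= addrA subrK.
have b1 : `|'d h (w t) p - 'd h w0 p| <= L * rho * (3 / 2 * K * `|v|).
  apply: (le_trans (lm_lip H _ _ _)).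
  rewrite ler_pM ?mulr_ge0//; apply: (lazy_flow_adjoint_le H).
  exact: (lazy_flow_in_tube H).
have b2 : `|'d h w0 (p - q)| <= K * (L * rho * `|v|).
  apply: (le_trans (lm_opnorm H _)); rewrite ler_wpM2l//.
  apply: (norm_adjointB_le v (@cd (w t)) (@cd w0)); first by rewrite mulr_ge0.
  by move=> x; rewrite (le_trans (lm_lip H _ _ _))// ler_wpM2r.
rewrite (le_trans (ler_normD _ _))// (le_trans (lerD b1 b2))//.
by rewrite le_eqVlt; apply/orP; left; apply/eqP; field.
Qed.

Let c := 5 / 2 * K * (L * rho) * G / s ^+ 2.

(** In the metric of the inverse Gram operator S at the initial point, the
    linearised output flow is the gradient flow of the strongly convex loss, so
    the gap z between the outputs is contracted at rate m and only driven by the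
    perturbation of the Gram operator:
    <z, S z>' <= - 2 m |z|^2 + 2 |z| c exp (- a t). *)
Lemma output_gap_le T : 0 <= T -> `|y T - ybar T| <= K * c / (m * s).
Proof.
move=> T0.
have [S SP] := gram_inverse_exists (@cd w0) s0 K0 (lm_opnorm H) (lm_singular H).
have Ssym := gram_inverse_sym SP.
pose z t := y t - ybar t.
pose z' t := - 'd h (w t) (adjoint ('d h (w t)) (g t)) -
  - 'd h w0 (adjoint ('d h w0) (gbar t)).
have dz (t : R) : 0 <= t -> is_derive t 1 z (z' t).
  move=> t0; apply: is_deriveB; first exact: (lazy_flow_output H t0).
  apply: (is_derive_eq (lazy_flow_output Hbar t0)).
  by rewrite adjoint_bar (diff_linearization (lm_diff H w0)).
have dSz (t : R) : 0 <= t -> is_derive t 1 (S \o z) (S (z' t)).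
  move=> t0; apply: (@is_derive_bounded_linear _ _ _ S (s ^- 2) _ _ _ _ _ _ (dz t t0)).
  - by move=> b x; exact: (gram_inverseZ SP).
  - by move=> x x'; exact: (gram_inverseB SP).
  by move=> x; rewrite mulrC; exact: (gram_inverse_le s0 (lm_singular H) SP).
have c0 : 0 <= c.
  by rewrite /c divr_ge0 ?sqr_ge0// (mulr_ge0 LK0).
(* the integral of the driving term c^2 exp (- 2 a t) / (2 m) *)
pose k := c ^+ 2 / (2 * m) / (2 * a).
have k0 : 0 <= k by rewrite /k !divr_ge0 ?sqr_ge0// mulr_ge0// ltW.
have decr : dot (z T) (S (z T)) + k * expR (- (2 * a) * T) <=
    dot (z 0) (S (z 0)) + k * expR (- (2 * a) * 0).
  apply: (@is_derive_nincr R (fun t => dot (z t) (S (z t)) + k * expR (- (2 * a) * t))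
    (fun t => dot (z' t) (S (z t)) + dot (z t) (S (z' t)) +
              k * (- (2 * a) * expR (- (2 * a) * t))) 0 T) => //.
    move=> t /andP[t0 _]; apply: is_deriveD.
      by apply: (is_derive_dot (dz t t0) (dSz t t0)).
    exact: (is_deriveZ k (is_derive_expRM (- (2 * a)) t)).
  move=> t /andP[/ltW t0 _].
  rewrite (dotC (z' t)) -(Ssym (z t)).
  have mono := gradient_strongly_monotone (lm_smooth H) (lm_convex H) (y t) (ybar t).
  have zE : dot (S (z t)) (z' t) =
      - dot (S (z t)) ('d h (w t) (adjoint ('d h (w t)) (g t)) -
                       'd h w0 (adjoint ('d h w0) (g t)))
      - dot (g t - gbar t) (z t).
    have key (x p q q' : F) :
        dot x (- p - - q') = - dot x (p - q) - dot x (q - q').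
      by rewrite !(dotBr, dotNr); ring.
    rewrite (dotC (g t - _)) -(SP (z t)) (dot_adjoint _ _ (@cd w0)).
    rewrite (adjointB _ _ (@cd w0)) linearB; exact: key.
  have pert := gram_perturbation (g t) t0.
  have gt := lazy_flow_gradient H t0.
  have Sz := gram_inverse_le s0 (lm_singular H) SP (z t).
  have drive : - dot (S (z t)) ('d h (w t) (adjoint ('d h (w t)) (g t)) -
      'd h w0 (adjoint ('d h w0) (g t))) <= `|z t| * (c * expR (- a * t)).
    rewrite -dotNr (le_trans (dot_le _ _))// normrN.
    have := ler_pM (normr_ge0 _) (normr_ge0 _) Sz
      (le_trans pert (ler_wpM2l LK0 gt)).
    move/le_trans; apply; rewrite le_eqVlt; apply/orP; left; apply/eqP.
    by rewrite /c /G -/r; field; rewrite gt_eqF.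
  (* completing the square: 2 x (c e) - 2 m x^2 <= (c e)^2 / (2 m) *)
  have key (P Q x e : R) : - P <= x * (c * e) -> m * x ^+ 2 <= Q ->
      (- P - Q) + (- P - Q) + k * (- (2 * a) * e ^+ 2) <= 0.
    move=> hP hQ.
    have -> : k * (- (2 * a) * e ^+ 2) = - ((c * e) ^+ 2 / (2 * m)).
      by rewrite /k; field; rewrite !gt_eqF.
    have : 0 <= (2 * m * x - c * e) ^+ 2 / (2 * m).
      by rewrite divr_ge0 ?sqr_ge0// mulr_ge0// ltW.
    have -> : (2 * m * x - c * e) ^+ 2 / (2 * m) =
        2 * (m * x ^+ 2) - 2 * (x * (c * e)) + (c * e) ^+ 2 / (2 * m).
      by field; rewrite gt_eqF.
    lra.
  have -> : expR (- (2 * a) * t) = expR (- a * t) ^+ 2.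
    by rewrite expr2 -expRD; congr expR; ring.
  by rewrite zE; exact: key drive mono.
have z00 : z 0 = 0.
  by rewrite /z /y /ybar (lf_start H) (lf_start Hbar) hbar0 subrr.
move: decr; rewrite z00 mulr0 expR0 mulr1 -{1}(scale0r (0 : F)) dotZl mul0r add0r.
move=> decr; have {}decr : dot (z T) (S (z T)) <= k.
  by apply: le_trans decr; rewrite lerDl mulr_ge0 ?expR_ge0.
have := norm_le_gram_inverse (@cd w0) K0 (lm_opnorm H) SP (z T).
move=> /le_trans/(_ (ler_wpM2l (sqr_ge0 K) decr)).
have -> : K ^+ 2 * k = (K * c / (m * s)) ^+ 2.
  by rewrite /k /a; field; rewrite !gt_eqF.
have Zge0 : 0 <= K * c / (m * s).
  by rewrite divr_ge0 ?(mulr_ge0 K0 c0)// (mulr_ge0 (ltW m0) (ltW s0)).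
by rewrite ler_pXn2r// nnegrE.
Qed.

Hypothesis al1 : 1 <= alpha.

Let rho1 := 6 * (M / m) * Num.sqrt (M / m) * K * r / s ^+ 2.
Let Z1 := K * (5 / 2 * K * (L * rho1) * G / s ^+ 2) / (m * s).
Let C := 2 * (L * rho1 * G + K * M * (Z1 + 2 * Num.sqrt (M / m) * r)).

(** The velocities differ by O(min(1 / alpha, exp (- a t)) / alpha), which is at
    most 2 / (alpha (alpha + exp (a t))) up to a constant; the integral of
    1 / (alpha + exp (a t)) over [0, +oo[ is ln (1 + alpha) / (a alpha), whence
    the logarithm. *)
Lemma weight_gap_le T : 0 <= T ->
  `|w T - wbar T| <= C / a * (ln (1 + alpha) / alpha ^+ 2).
Proof.
move=> T0.
pose p t := C / (a * alpha ^+ 2) * (a * t - ln (alpha + expR (a * t))).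
pose p' t := C / (a * alpha ^+ 2) * (a - a * expR (a * t) / (alpha + expR (a * t))).
have pos t : 0 < alpha + expR (a * t) by rewrite addr_gt0// expR_gt0.
have rho1E : rho = rho1 / alpha by rewrite /rho /rho1; field; rewrite !gt_eqF.
have rho10 : 0 <= rho1.
  by have := mulr_ge0 rho0 (ltW al0); rewrite rho1E divfK// gt_eqF.
have kr0 : 0 <= 2 * Num.sqrt (M / m) * r by rewrite !mulr_ge0 ?sqrtr_ge0.
have LK1 : 0 <= 5 / 2 * K * (L * rho1).
  by rewrite mulr_ge0 ?(mulr_ge0 L0 rho10)// mulr_ge0// divr_ge0.
have Z10 : 0 <= Z1.
  rewrite /Z1 divr_ge0 ?(mulr_ge0 (ltW m0) (ltW s0))// (mulr_ge0 K0)//.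
  by rewrite divr_ge0 ?sqr_ge0// (mulr_ge0 LK1 G0).
have LG0 : 0 <= L * rho1 * G by rewrite (mulr_ge0 (mulr_ge0 L0 rho10) G0).
have C0 : 0 <= C.
  rewrite /C mulr_ge0// addr_ge0// (mulr_ge0 (mulr_ge0 K0 (ltW M0)))//.
  by rewrite addr_ge0.
have : `|(w T - wbar T) - (w 0 - wbar 0)| <= p T - p 0.
  pose u' t := - (alpha^-1 *: adjoint ('d h (w t)) (g t)) -
    - (alpha^-1 *: adjoint ('d hbar (wbar t)) (gbar t)).
  apply: (@is_derive_norm_le R V (fun t => w t - wbar t) u' p p' 0 T).
  - exact: T0.
  - move=> t /andP[t0 _].
    exact: (is_deriveB (lf_flow H t0) (lf_flow Hbar t0)).
  - move=> t _; apply: (is_deriveZ (C / (a * alpha ^+ 2))).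
    apply: is_deriveB.
      by have := is_deriveZ a (is_derive_id t 1); rewrite [a *: 1]mulr1.
    pose q : R -> R := fun t => alpha + expR (a * t).
    have dq : is_derive t 1 q (0 + a * expR (a * t)).
      by apply: is_deriveD; exact: is_derive_expRM.
    have := @is_derive1_comp R (@ln R) q t _ _ (is_derive1_ln (pos t)) dq.
    by rewrite add0r mulrC.
  move=> t /andP[/ltW t0 _].
  rewrite /u' -opprD normrN adjoint_bar.
  rewrite -scalerN -scalerDr normrZ gtr0_norm ?invr_gt0//.
  have -> : adjoint ('d h (w t)) (g t) - adjoint ('d h w0) (gbar t) =
      (adjoint ('d h (w t)) (g t) - adjoint ('d h w0) (g t)) +
      adjoint ('d h w0) (g t - gbar t).
    by rewrite (adjointB _ _ (@cd w0)) addrA subrK.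
  have e1 : 1 <= expR (a * t) by rewrite -expR0 ler_expR mulr_ge0// ltW.
  have eN : expR (- a * t) = (expR (a * t))^-1 by rewrite mulNr expRN.
  have b1 : `|adjoint ('d h (w t)) (g t) - adjoint ('d h w0) (g t)| <=
      L * rho1 * G * (2 / (alpha + expR (a * t))).
    have gt := lazy_flow_gradient H t0.
    apply: (@le_trans _ _ (L * rho * (G * expR (- a * t)))).
      have Lr : 0 <= L * rho by rewrite mulr_ge0.
      apply: le_trans (ler_wpM2l Lr gt).
      apply: (norm_adjointB_le _ (@cd (w t)) (@cd w0)) => // x.
      rewrite (le_trans (lm_lip H _ _ _))// ler_wpM2r// ler_wpM2l//.
      exact: (lazy_flow_displacement H).
    rewrite rho1E eN.
    have -> : L * (rho1 / alpha) * (G * (expR (a * t))^-1) =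
        L * rho1 * G * ((alpha * expR (a * t))^-1).
      by rewrite invfM; ring.
    rewrite ler_wpM2l// -[leLHS]mul1r ler_pdivrMr ?mulr_gt0 ?expR_gt0//.
    rewrite mulrAC ler_pdivlMr// mul1r.
    have := ler_wpM2l (ltW al0) e1; have := ler_wpM2r (expR_ge0 (a * t)) al1.
    lra.
  have b2 : `|adjoint ('d h w0) (g t - gbar t)| <=
      K * M * (Z1 + 2 * Num.sqrt (M / m) * r) * (2 / (alpha + expR (a * t))).
    apply: (le_trans (norm_adjoint_le _ (@cd w0) K0 (lm_opnorm H))).
    rewrite -[leRHS]mulrA -[leRHS]mulrA ler_wpM2l//.
    apply: (le_trans (gradient_lipschitz (lm_smooth H) _ _)).
    rewrite ler_wpM2l ?(ltW M0)//; apply: le_harmonic => //.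
    - by rewrite expR_gt0.
    - rewrite (le_trans (output_gap_le t0))// /c rho1E /Z1.
      by rewrite le_eqVlt; apply/orP; left; apply/eqP; field; rewrite !gt_eqF.
    have yb := lazy_flow_convergence H t0.
    have := lazy_flow_convergence Hbar t0; rewrite hbar0 => ybb.
    have -> : y t - ybar t = (y t - ystar) - (ybar t - ystar).
      by rewrite opprB addrA subrK.
    apply: (le_trans (ler_normB _ _)); apply: (le_trans (lerD yb ybb)).
    by rewrite -/a -/r eN le_eqVlt; apply/orP; left; apply/eqP; ring.
  apply: (@le_trans _ _ (alpha^-1 * (L * rho1 * G * (2 / (alpha + expR (a * t))) +
    K * M * (Z1 + 2 * Num.sqrt (M / m) * r) * (2 / (alpha + expR (a * t)))))).
    rewrite ler_wpM2l ?invr_ge0 ?(ltW al0)//.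
    by rewrite (le_trans (ler_normD _ _))// lerD.
  rewrite le_eqVlt; apply/orP; left; apply/eqP; rewrite /p' /C.
  by field; rewrite !gt_eqF.
rewrite (lf_start H) (lf_start Hbar) subrr subr0 => /le_trans; apply.
have aT : a * T <= ln (alpha + expR (a * T)).
  by rewrite -[leLHS]expRK ler_ln ?posrE ?expR_gt0// lerDr ltW.
have Ca : 0 <= C / (a * alpha ^+ 2).
  by rewrite divr_ge0// (mulr_ge0 (ltW a0)) ?sqr_ge0.
have -> : C / a * (ln (1 + alpha) / alpha ^+ 2) =
    C / (a * alpha ^+ 2) * ln (1 + alpha) by field; rewrite !gt_eqF.
rewrite /p mulr0 expR0 sub0r -mulrBr ler_wpM2l// opprK (addrC alpha 1) gerDr.
by rewrite subr_le0.
Qed.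

End Comparison.

(** * From gradient flows to lazy flows *)

Section FlowsOfTheModel.
Context {R : realType} {V F : hilbertType R}.

Lemma gradient_scaled_objective (h : V -> F) (loss : F -> R) (alpha : R) x :
  alpha != 0 -> differentiable h x -> differentiable loss (alpha *: h x) ->
  gradient (scaled_objective loss h alpha) x =
    alpha^-1 *: adjoint ('d h x) (gradient loss (alpha *: h x)).
Proof.
move=> al0 /[dup] dh /differentiableP isdh /[dup] dl /differentiableP isdl.
have isd := is_diffZ (alpha ^+ 2)^-1 (is_diff_comp (is_diffZ alpha isdh) isdl).
apply: rieszP => v.
have -> : 'd (scaled_objective loss h alpha) x v =
    (alpha ^+ 2)^-1 * 'd loss (alpha *: h x) (alpha *: 'd h x v).
  have := @diff_val _ _ _ _ _ _ _ isd.
  by move=> /(congr1 (fun f => f v)).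
rewrite dotZl dot_adjoint; last exact: diff_continuous.
rewrite dot_gradient// linearZ /= /GRing.scale /=.
by field.
Qed.

Lemma lazy_flow_of_gradient_flow (h : V -> F) (loss : F -> R) (M m : R)
    (ystar : F) (w0 : V) (L K s alpha : R) (w : R -> V) :
  lazy_model h loss M m ystar w0 L K s -> 0 < alpha ->
  gradient_flow (scaled_objective loss h alpha) w0 w ->
  12 * (M / m) * Num.sqrt (M / m) * K * L * `|alpha *: h w0 - ystar|
    < alpha * s ^+ 3 ->
  exists2 u : R -> V, (forall t : R, 0 <= t -> u t = w t) &
    lazy_flow h loss M m ystar w0 L K s alpha u.
Proof.
move=> LM al0 [w00 dw] close.
have [u uw du] := extend_one_sided dw.
exists u => //; split=> // [|t t0]; first by rewrite uw.
have := du t t0; rewrite -(uw t t0) gradient_scaled_objective//.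
- by rewrite gt_eqF.
- exact: (lm_diff LM).
- exact: (lm_smooth LM).1.
Qed.

Lemma lazy_model_linearization (h : V -> F) (loss : F -> R) (M m : R)
    (ystar : F) (w0 : V) (L K s : R) :
  lazy_model h loss M m ystar w0 L K s ->
  lazy_model (linearization h w0) loss M m ystar w0 0 K s.
Proof.
move=> LM; have dh := lm_diff LM w0; have dE x := diff_linearization dh x.
split; rewrite ?dE//; try by case: LM.
  by move=> x; exact: differentiable_linearization.
by move=> x y v; rewrite !dE subrr normr0 !mul0r.
Qed.

Lemma lazy_model_of_hypotheses (h : V -> F) (loss : F -> R) (M m : R)
    (ystar : F) (w0 : V) :
  has_lipschitz_diff h -> smooth M loss -> strongly_convex m loss ->
  (forall y, loss ystar <= loss y) ->
  0 < smallest_singular_value (adjoint ('d h w0)) ->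
  lazy_model h loss M m ystar w0 (lip_diff h) (opnorm ('d h w0))
    (smallest_singular_value (adjoint ('d h w0))).
Proof.
move=> hlip lsm lsc lmin; set s := smallest_singular_value _ => s0.
have cA : continuous ('d h w0) by exact: diff_continuous (hlip.1 w0).
have AK := le_opnorm_linear cA.
have As y := smallest_singular_value_le (adjoint ('d h w0)) y.
(* on the zero space every constant is admissible and the default value 0 results *)
have [y y0] : exists y : F, y != 0.
  apply: contrapT => /forallNP F0; move: s0; rewrite /s /smallest_singular_value.
  rewrite sup_out ?ltxx// => -[_ [b /= bub]].
  have : b + 1 <= b; last by rewrite gerDl ler10.
  apply: bub => v; have /negP := F0 v; rewrite negbK => /eqP ->.
  by rewrite normr0 mulr0.
have sy : 0 < s * `|y| by rewrite mulr_gt0// normr_gt0.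
have Ay : 0 < `|adjoint ('d h w0) y| := lt_le_trans sy (As y).
have K0 : 0 <= opnorm ('d h w0).
  by have := le_trans (normr_ge0 _) (AK (adjoint ('d h w0) y)); rewrite pmulr_lge0.
split=> //.
- exact: hlip.1.
- exact: lip_diff_ge0.
- exact: lip_diff_le.
- by have := le_trans (As y) (norm_adjoint_le y cA K0 AK); rewrite ler_pM2r// normr_gt0.
- exact: (modulus_le_smoothness lsm lsc y0).
Qed.

End FlowsOfTheModel.

(** The threshold on alpha in terms of C0 is stronger than what keeps the weights
    in the tube: |alpha h(w0) - y*| <= alpha |h(w0)| + |y*| < 2 alpha C0. *)
Lemma threshold_close (R : realType) (F : normedModType R) (h0 ystar : F)
    (kappa s K L alpha : R) :
  0 < kappa -> 0 < s -> 0 < K -> 0 <= L -> 0 < alpha ->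
  let C0 := ((s ^+ 3)%:E / (32 * kappa `^ (3 / 2) * K * L)%:E)%E in
  (`|h0|%:E <= C0)%E -> (`|ystar|%:E / C0 < alpha%:E)%E ->
  12 * kappa * Num.sqrt kappa * K * L * `|alpha *: h0 - ystar| < alpha * s ^+ 3.
Proof.
move=> k0 s0 K0; rewrite le_eqVlt => /orP[/eqP<- al0 _ _ _|L0 al0].
  by rewrite mulr0 mul0r mulr_gt0// exprn_gt0.
have -> : kappa `^ (3 / 2) = kappa * Num.sqrt kappa.
  have -> : 3 / 2 = 1 + 2^-1 :> R by field.
  by rewrite powRD ?(gt_eqF k0) ?implybT// powRr1 ?ltW// powR12_sqrt// ltW.
set P := kappa * Num.sqrt kappa * K * L.
have P0 : 0 < P by rewrite !mulr_gt0// sqrtr_gt0.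
have -> : 32 * (kappa * Num.sqrt kappa) * K * L = 32 * P by rewrite /P; ring.
have -> : 12 * kappa * Num.sqrt kappa * K * L = 12 * P by rewrite /P; ring.
have P32 : 32 * P == 0 = false by rewrite gt_eqF// mulr_gt0.
have c0 : 0 < s ^+ 3 / (32 * P) by rewrite divr_gt0 ?exprn_gt0// mulr_gt0.
rewrite /= inver P32 -EFinM lee_fin inver (gt_eqF c0) -EFinM lte_fin.
rewrite ltr_pdivrMr// => h0C yC.
have : `|alpha *: h0 - ystar| < 2 * (alpha * (s ^+ 3 / (32 * P))).
  rewrite (le_lt_trans (ler_normB _ _))// normrZ gtr0_norm//.
  by have := ler_wpM2l (ltW al0) h0C; lra.
have P12 : 0 < 12 * P by rewrite mulr_gt0.
rewrite -(ltr_pM2l P12) => /lt_trans; apply.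
have -> : 12 * P * (2 * (alpha * (s ^+ 3 / (32 * P)))) = alpha * s ^+ 3 * (3 / 4).
  by field; rewrite gt_eqF.
by rewrite gtr_pMr ?mulr_gt0 ?exprn_gt0//; lra.
Qed.

Lemma sup_bigO_ge (R : realType) (u : R -> R -> R) (g : R -> R) (C alpha0 : R) :
  (forall alpha t, alpha0 <= alpha -> 0 <= t -> u alpha t <= C * `|g alpha|) ->
  sup_bigO u g.
Proof.
move=> ug; exists C.
apply: filterS (nbhs_pinfty_ge (num_real alpha0)) => alpha /= al.
by apply: ge_ereal_sup => _ [t /= t0 <-]; rewrite lee_fin ug.
Qed.

Unset Implicit Arguments.

Theorem theorem2p4 (R : realType) (F : hilbertType R) (p : nat)
    (h : euclid R p -> F) (loss : F -> R) (M m : R) (ystar : F)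
    (w0 : euclid R p) (w wbar : R -> R -> euclid R p) :
  let sigma := smallest_singular_value (adjoint ('d h w0)) in
  let kappa := M / m in
  let C0 : \bar R :=
    ((sigma ^+ 3)%:E /
     (32 * kappa `^ (3 / 2) * opnorm ('d h w0) * lip_diff h)%:E)%E in
  let hbar := linearization h w0 in
  has_lipschitz_diff h ->
  (forall y, 0 <= loss y) ->
  smooth M loss ->
  strongly_convex m loss ->
  (forall y, loss ystar <= loss y) ->
  0 < sigma ->
  (`|h w0|%:E <= C0)%E ->
  (forall alpha : R, 0 < alpha ->
     gradient_flow (scaled_objective loss h alpha) w0 (w alpha)) ->
  (forall alpha : R, 0 < alpha ->
     gradient_flow (scaled_objective loss hbar alpha) w0 (wbar alpha)) ->
  (forall alpha : R, 0 < alpha -> (`|ystar|%:E / C0 < alpha%:E)%E ->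
     forall t : R, 0 <= t ->
       `|alpha *: h (w alpha t) - ystar| <=
         Num.sqrt kappa * `|alpha *: h w0 - ystar| *
         expR (- m * sigma ^+ 2 * t / 4)) /\
  (h w0 = 0 ->
     [/\ sup_bigO (fun alpha t => `|w alpha t - w0|) (fun alpha => alpha^-1),
         sup_bigO (fun alpha t =>
             `|alpha *: h (w alpha t) - alpha *: hbar (wbar alpha t)|)
           (fun alpha => alpha^-1)
       & sup_bigO (fun alpha t => `|w alpha t - wbar alpha t|)
           (fun alpha => ln alpha / alpha ^+ 2)]).
Proof.
move=> sigma kappa C0 hbar hlip _ lsm lsc lmin s0 hC flow flowbar.
have LM := lazy_model_of_hypotheses hlip lsm lsc lmin s0.
have LMbar := lazy_model_linearization LM.
rewrite -/sigma in LM LMbar.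
set L := lip_diff h in LM C0 hC *; set K := opnorm ('d h w0) in LM LMbar C0 hC *.
have m0 : 0 < m := lsc.1.
have k0 : 0 < kappa by rewrite divr_gt0// (lt_le_trans m0 (lm_m_le_M LM)).
have K0 : 0 < K := lt_le_trans s0 (lm_s_le_K LM).
split=> [alpha al0 thr t t0|h00].
  have close := threshold_close k0 s0 K0 (lm_L_ge0 LM) al0 hC thr.
  have [u uw Hu] := lazy_flow_of_gradient_flow LM al0 (flow alpha al0) close.
  have := lazy_flow_convergence Hu t0; rewrite uw// => /le_trans; apply.
  rewrite le_eqVlt; apply/orP; left; apply/eqP; congr (_ * expR _).
  by field.
pose r := `|ystar|.
(* alpha > q confines the flow to the tube; alpha >= 2 serves the logarithm *)
pose q := 12 * kappa * Num.sqrt kappa * K * L * r / sigma ^+ 3.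
have q0 : 0 <= q.
  have k12 : 0 <= 12 * kappa * Num.sqrt kappa.
    by rewrite mulr_ge0 ?sqrtr_ge0// mulr_ge0// ltW.
  rewrite divr_ge0 ?exprn_ge0 ?(ltW s0)// mulr_ge0 ?normr_ge0//.
  by rewrite (mulr_ge0 (mulr_ge0 k12 (ltW K0)) (lm_L_ge0 LM)).
have rE alpha : `|alpha *: h w0 - ystar| = r by rewrite h00 scaler0 sub0r normrN.
have flows alpha : q + 2 <= alpha -> exists u ubar : R -> euclid R p,
    [/\ forall t : R, 0 <= t -> u t = w alpha t /\ ubar t = wbar alpha t,
        lazy_flow h loss M m ystar w0 L K sigma alpha u &
        lazy_flow hbar loss M m ystar w0 0 K sigma alpha ubar].
  move=> qa; have al0 : 0 < alpha by lra.
  have close : 12 * (M / m) * Num.sqrt (M / m) * K * L *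
      `|alpha *: h w0 - ystar| < alpha * sigma ^+ 3.
    rewrite rE -ltr_pdivrMr ?exprn_gt0// -/kappa -/q; lra.
  have closebar : 12 * (M / m) * Num.sqrt (M / m) * K * 0 *
      `|alpha *: hbar w0 - ystar| < alpha * sigma ^+ 3.
    by rewrite mulr0 mul0r mulr_gt0// exprn_gt0.
  have [u uw Hu] := lazy_flow_of_gradient_flow LM al0 (flow alpha al0) close.
  have [ub ubw Hub] :=
    lazy_flow_of_gradient_flow LMbar al0 (flowbar alpha al0) closebar.
  by exists u, ub; split=> // t t0; rewrite uw// ubw.
pose rho := 6 * (M / m) * Num.sqrt (M / m) * K * r / sigma ^+ 2.
pose G := M * Num.sqrt (M / m) * r.
pose Z := K * (5 / 2 * K * (L * rho) * G / sigma ^+ 2) / (m * sigma).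
pose C := 2 * (L * rho * G + K * M * (Z + 2 * Num.sqrt (M / m) * r)).
have nz : (m != 0) * (sigma != 0) by rewrite !gt_eqF.
split.
- apply: (@sup_bigO_ge _ _ _ rho (q + 2)) => alpha t qa t0.
  have al0 : 0 < alpha by lra.
  have [u [ub [uw Hu _]]] := flows alpha qa.
  rewrite -(uw t t0).1 (le_trans (lazy_flow_displacement Hu t0))// rE.
  rewrite gtr0_norm ?invr_gt0// le_eqVlt; apply/orP; left; apply/eqP.
  by rewrite /rho; field; rewrite !nz gt_eqF.
- apply: (@sup_bigO_ge _ _ _ Z (q + 2)) => alpha t qa t0.
  have al0 : 0 < alpha by lra.
  have [u [ub [uw Hu Hub]]] := flows alpha qa.
  have [<- <-] := uw t t0.
  rewrite (le_trans (output_gap_le Hu Hub t0))// rE.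
  rewrite gtr0_norm ?invr_gt0// le_eqVlt; apply/orP; left; apply/eqP.
  by rewrite /Z /rho /G; field; rewrite !nz gt_eqF.
apply: (@sup_bigO_ge _ _ _ (2 * (C / (m * sigma ^+ 2 / 4))) (q + 2)) => alpha t qa t0.
have al1 : 1 <= alpha by lra.
have al0 : 0 < alpha by lra.
have [u [ub [uw Hu Hub]]] := flows alpha qa.
have [<- <-] := uw t t0.
have gap := weight_gap_le Hu Hub al1 t0; rewrite rE -/rho -/G -/Z -/C in gap.
have D0 : 0 <= C / (m * sigma ^+ 2 / 4).
  have ln0 : 0 < ln (1 + alpha) / alpha ^+ 2.
    by rewrite divr_gt0 ?exprn_gt0// ln_gt0//; lra.
  by have := le_trans (normr_ge0 _) gap; rewrite pmulr_lge0.
apply: (le_trans gap); rewrite [2 * _]mulrC -[leRHS]mulrA ler_wpM2l//.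
rewrite ger0_norm; last by rewrite divr_ge0 ?sqr_ge0// ln_ge0.
rewrite mulrA ler_pM2r ?invr_gt0 ?exprn_gt0//.
(* 1 + alpha <= alpha ^ 2 as soon as alpha >= 2 *)
have -> : 2 * ln alpha = ln (alpha ^+ 2) by rewrite lnXn// mulr_natl.
rewrite ler_ln ?posrE ?exprn_gt0//; last by lra.
rewrite expr2; have := ler_wpM2r (ltW al0) (_ : 2 <= alpha); lra.
Qed.
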